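(* Let $k \geq 2$ and $1 \leq i \leq k$ be integers. Define the formal power series $$R_{k,i}(a,b;x;q) = \frac{(-axq,-bxq;q)_{\infty}}{(xq,abxq;q)_{\infty}} \sum_{n\geq 0} \frac{(-ab)^n x^{kn} q^{kn^2 +(k-i+1)n - \binom{n}{2}} (-1/a,-1/b;q)_n(xq;q)_n}{(q,-axq,-bxq;q)_n}\left( 1 - \frac{abx^iq^{(2n+1)i - 2n}(1+q^n/a)(1+q^n/b)}{(1+axq^{n+1})(1+bxq^{n+1})} \right),$$ and write $R_{k,i}(a,b;x;q) = \sum_{s,t,m,n \geq 0} r_{k,i}(s,t,m,n)a^sb^tx^mq^n$. Then $r_{k,i}(s,t,m,n)$ equals the number of overpartition pairs $(\lambda,\mu)$ of $n$ with $m$ parts in total, $s$ of which are either overlined and in $\lambda$ or non-overlined and in $\mu$, and $t$ of which are in $\mu$, such that (i) $v_1((\lambda,\mu)) \leq i-1$, and (ii) for each $j \geq 1$, $f_j(\lambda) + v_{j+1}((\lambda,\mu)) \leq k-1$.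
   Context: Notation: $(a;q)_n=\prod_{j=0}^{n-1}(1-aq^j)$, $(a;q)_\infty=\prod_{j\ge0}(1-aq^j)$, and $(a_1,\dots,a_r;q)_n=(a_1;q)_n\cdots(a_r;q)_n$. An overpartition is a partition in which the first occurrence of each part size may be overlined; an overpartition pair $(\lambda,\mu)$ of $n$ is a pair of overpartitions whose parts (all positive) sum in total to $n$. For an overpartition $\lambda$, $f_j(\lambda)$ is the number of non-overlined occurrences of $j$ in $\lambda$ and $f_{\overline{j}}(\lambda)\in\{0,1\}$ the number of occurrences of $\overline{j}$. A positive integer $j$ occurs unattached in $(\lambda,\mu)$ if $j$ occurs in the pair only non-overlined and only in $\mu$ (i.e. $j$ is a non-overlined part of $\mu$, and none of $j,\overline{j}$ is a part of $\lambda$ and $\overline{j}$ is not a part of $\mu$). The valuation at $j$ is $v_j((\lambda,\mu)) = f_{j}(\lambda) + f_{\overline{j}}(\lambda) + f_{\overline{j}}(\mu) + \chi(j \text{ occurs unattached in } (\lambda,\mu))$, where $\chi$ is the indicator function. *)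

(* Defs.v *)
From HB Require Import structures.
From mathcomp Require Import all_boot all_order all_algebra.
From mathcomp Require Import boolp classical_sets functions cardinality.

Set Implicit Arguments.
Unset Strict Implicit.
Unset Printing Implicit Defensive.

Import GRing.Theory.
Local Open Scope classical_set_scope.
Local Open Scope ring_scope.

Record fps (R : Type) := Fps { fps_coef :> nat -> R }.

Notation "{ 'fps' R }" := (fps R) (format "{ 'fps'  R }") : type_scope.

HB.instance Definition _ (R : Type) := gen_eqMixin {fps R}.
HB.instance Definition _ (R : Type) := gen_choiceMixin {fps R}.

Lemma fpsP (R : Type) (f g : {fps R}) : f =1 g <-> f = g.
Proof. by split=> [|-> //]; case: f g => [f] [g] /= /funext ->. Qed.

Section FpsRing.
Variable R : comNzRingType.
Implicit Types f g h : {fps R}.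

Definition fps_const (c : R) : {fps R} := Fps (fun n => if n is 0%N then c else 0).
Definition fps_var : {fps R} := Fps (fun n => (n == 1%N)%:R).

Definition fps_add f g : {fps R} := Fps (fun n => f n + g n).
Definition fps_opp f : {fps R} := Fps (fun n => - f n).
Definition fps_mul f g : {fps R} := Fps (fun n => \sum_(j < n.+1) f j * g (n - j)%N).

Fact fps_addA : associative fps_add.
Proof. by move=> f g h; apply/fpsP => n /=; rewrite addrA. Qed.
Fact fps_addC : commutative fps_add.
Proof. by move=> f g; apply/fpsP => n /=; rewrite addrC. Qed.
Fact fps_add0 : left_id (fps_const 0) fps_add.
Proof. by move=> f; apply/fpsP => -[|n] /=; rewrite add0r. Qed.
Fact fps_addN : left_inverse (fps_const 0) fps_opp fps_add.
Proof. by move=> f; apply/fpsP => -[|n] /=; rewrite addNr. Qed.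

HB.instance Definition _ :=
  GRing.isZmodule.Build {fps R} fps_addA fps_addC fps_add0 fps_addN.

Lemma fps_mul_trunc N f g n : (n < N)%N ->
  fps_mul f g n = (\poly_(j < N) f j * \poly_(j < N) g j)`_n.
Proof.
move=> ltnN; rewrite coefM; apply: eq_bigr => -[j /=]; rewrite ltnS => lejn _.
by rewrite !coef_poly (leq_ltn_trans lejn ltnN) (leq_ltn_trans (leq_subr _ _) ltnN).
Qed.

Fact fps_mulC : commutative fps_mul.
Proof.
by move=> f g; apply/fpsP => n; rewrite !(fps_mul_trunc _ _ (ltnSn n)) mulrC.
Qed.
Fact fps_mulA : associative fps_mul.
Proof.
move=> f g h; apply/fpsP => n; set P := fun f' : {fps R} => \poly_(j < n.+1) f' j.
transitivity ((P f * (P g * P h))`_n); last rewrite mulrA.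
  rewrite coefM; apply: eq_bigr => -[j /=]; rewrite ltnS => lejn _.
  by rewrite coef_poly ltnS lejn -fps_mul_trunc // ltnS leq_subr.
rewrite coefM; apply/esym/eq_bigr => -[j /=]; rewrite ltnS => lejn _.
by rewrite coef_poly ltnS leq_subr -fps_mul_trunc.
Qed.
Fact fps_mul1 : left_id (fps_const 1) fps_mul.
Proof.
move=> f; apply/fpsP => n /=; rewrite big_ord_recl /= mul1r subn0.
by rewrite big1 ?addr0 // => j _; rewrite mul0r.
Qed.
Fact fps_mulDl : left_distributive fps_mul fps_add.
Proof.
move=> f g h; apply/fpsP => n /=; rewrite -big_split /=.
by apply: eq_bigr => j _; rewrite mulrDl.
Qed.
Fact fps_one_neq0 : fps_const 1 != 0.
Proof. by apply/eqP => /fpsP /(_ 0%N) /= /eqP; rewrite oner_eq0. Qed.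

HB.instance Definition _ := GRing.Zmodule_isComNzRing.Build {fps R}
  fps_mulA fps_mulC fps_mul1 fps_mulDl fps_one_neq0.

(* The limit of a sequence of series for the topology of coefficientwise
   convergence, [R] being discrete: the coefficient of index [n] is the eventual
   value of the coefficients of index [n] (and 0 by default if there is none). *)
Definition fps_lim (u : nat -> {fps R}) : {fps R} :=
  Fps (fun n => xget 0 [set c | exists N, forall M, (N <= M)%N -> u M n = c]).

Lemma fps_limE (u : nat -> {fps R}) n c :
  (exists N, forall M, (N <= M)%N -> u M n = c) -> fps_lim u n = c.
Proof.
move=> uc /=; case: xgetP => [d _ [N ud]|/(_ c)//]; case: uc => N' uc.
by rewrite -(ud _ (leq_maxl N N')) (uc _ (leq_maxr N N')).
Qed.

Definition fps_sum (u : nat -> {fps R}) : {fps R} :=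
  fps_lim (fun N => \sum_(n < N) u n).

End FpsRing.

Arguments fps_var {R}.

Section FpsUnitRing.
Variable R : comUnitRingType.
Implicit Types f g : {fps R}.

Definition fps_unit : pred {fps R} := [pred f : {fps R} | f 0%N \is a GRing.unit].

Fixpoint fps_inv_seq f n : seq R :=
  if n is n'.+1 then
    let s := fps_inv_seq f n' in
    rcons s (if n' is 0%N then (f 0%N)^-1
             else - (f 0%N)^-1 * \sum_(j < n') s`_j * f (n' - j)%N)
  else [::].

Definition fps_inv f : {fps R} :=
  if f \in fps_unit then Fps (fun n => (fps_inv_seq f n.+1)`_n) else f.

Lemma size_fps_inv_seq f n : size (fps_inv_seq f n) = n.
Proof. by elim: n => //= n IHn; rewrite size_rcons IHn. Qed.

Lemma nth_fps_inv_seq f n j : (j < n)%N ->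
  (fps_inv_seq f n)`_j = (fps_inv_seq f j.+1)`_j.
Proof.
elim: n => // n IHn; rewrite ltnS leq_eqVlt => /predU1P[-> //|ltjn].
by rewrite [LHS]/= nth_rcons size_fps_inv_seq ltjn IHn.
Qed.

Fact fps_mulVf : {in fps_unit, left_inverse 1 fps_inv *%R}.
Proof.
move=> f Uf; rewrite /fps_inv Uf; apply/fpsP => n.
have -> : (Fps (fun m => (fps_inv_seq f m.+1)`_m) * f) n
    = \sum_(j < n.+1) (fps_inv_seq f n.+1)`_j * f (n - j)%N.
  by apply: eq_bigr => j _; congr (_ * _); rewrite (nth_fps_inv_seq f (ltn_ord j)).
have {}Uf : f 0%N \is a GRing.unit by [].
rewrite big_ord_recr subnn /= nth_rcons size_fps_inv_seq ltnn eqxx.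
case: n => [|n]; first by rewrite big_ord0 add0r mulVr.
rewrite mulrAC [_ * f 0%N]mulNr mulVr // mulN1r; apply/eqP; rewrite subr_eq0; apply/eqP.
by apply: eq_bigr => j _; rewrite [in LHS]nth_rcons size_fps_inv_seq ltn_ord.
Qed.

Fact fps_unitP f g : g * f = 1 -> f \in fps_unit.
Proof.
move=> /fpsP /(_ 0%N) /=; rewrite big_ord1 subnn => gf1.
by apply/unitrPr; exists (g 0%N); rewrite mulrC.
Qed.

Fact fps_inv_out : {in [predC fps_unit], fps_inv =1 id}.
Proof. by move=> f /negPf Nf; rewrite /fps_inv Nf. Qed.

HB.instance Definition _ := GRing.ComNzRing_hasMulInverse.Build {fps R}
  fps_mulVf fps_unitP fps_inv_out.

End FpsUnitRing.

Definition qpoch (A : comNzRingType) (a q : A) (n : nat) : A :=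
  \prod_(j < n) (1 - a * q ^+ j).

Definition qpoch_inf (A : comNzRingType) (a q : {fps A}) : {fps A} :=
  fps_lim (qpoch a q).

(* For 1 <= i <= k the subtractions in the exponents do not truncate. *)
Definition Rseries (A : comUnitRingType) (k i : nat) (a b x q : {fps A}) : {fps A} :=
  (qpoch_inf (- a * x * q) q * qpoch_inf (- b * x * q) q)
  / (qpoch_inf (x * q) q * qpoch_inf (a * b * x * q) q)
  * fps_sum (fun n : nat =>
      ((- (a * b)) ^+ n * x ^+ (k * n)
       * q ^+ (k * n ^ 2 + (k - i + 1) * n - 'C(n, 2))
       * (qpoch (- a^-1) q n * qpoch (- b^-1) q n) * qpoch (x * q) q n)
      / (qpoch q q n * qpoch (- a * x * q) q n * qpoch (- b * x * q) q n)
      * (1 - (a * b * x ^+ i * q ^+ ((2 * n + 1) * i - 2 * n)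
              * (1 + q ^+ n / a) * (1 + q ^+ n / b))
             / ((1 + a * x * q ^+ n.+1) * (1 + b * x * q ^+ n.+1)))).

(* Since 1/a and 1/b occur, the computation takes place in Q(a,b)[[x]][[q]]:
   a is the outer and b the inner variable of Z[b][a], whose fraction field is
   Q(a,b), and [F n m] is the coefficient of x^m q^n in [F]. *)
Definition Qab : fieldType := {fraction {poly {poly int}}}.
Definition Qabxq : comUnitRingType := {fps {fps Qab}}.

Definition ser_a : Qabxq := fps_const (fps_const (tofrac 'X)).
Definition ser_b : Qabxq := fps_const (fps_const (tofrac 'X%:P)).
Definition ser_x : Qabxq := fps_const fps_var.
Definition ser_q : Qabxq := fps_var.

Definition R_ (k i : nat) : Qabxq := Rseries k i ser_a ser_b ser_x ser_q.

(* F = \sum_(s, t, m, n >= 0) r(s,t,m,n) a^s b^t x^m q^n, where for given m and n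
   only finitely many r(s,t,m,n) are nonzero: the coefficient of x^m q^n in [F] is
   a polynomial of Z[a,b] whose coefficient of a^s b^t is r(s,t,m,n). *)
Definition has_expansion (F : Qabxq) (r : nat -> nat -> nat -> nat -> int) : Prop :=
  forall m n : nat, exists2 p : {poly {poly int}},
    F n m = tofrac p & forall s t : nat, p`_s`_t = r s t m n.

(* A part is a pair (size, overlined?); parts are listed by nonincreasing size, so
   an overlined part is a first occurrence iff its predecessor is strictly larger. *)
Definition is_overpartition (l : seq (nat * bool)) : bool :=
  all (fun p => 0 < p.1)%N l &&
  sorted (fun p p' => (p'.1 <= p.1)%N && (p'.2 ==> (p'.1 < p.1)%N)) l.

Record overpartition :=
  Overpartition { op_parts :> seq (nat * bool); _ : is_overpartition op_parts }.

HB.instance Definition _ := [isSub for op_parts].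
HB.instance Definition _ := [Choice of overpartition by <:].

Definition op_weight (l : overpartition) : nat := sumn [seq p.1 | p <- l].

Definition freq (j : nat) (l : overpartition) : nat := count_mem (j, false) l.
Definition freq_over (j : nat) (l : overpartition) : nat := count_mem (j, true) l.

Definition unattached (j : nat) (la mu : overpartition) : bool :=
  [&& (j, false) \in op_parts mu, (j, true) \notin op_parts mu,
      (j, false) \notin op_parts la & (j, true) \notin op_parts la].

Definition valuation (j : nat) (la mu : overpartition) : nat :=
  (freq j la + freq_over j la + freq_over j mu + unattached j la mu)%N.

Definition overpartition_pairs (k i s t m n : nat) :
    set (overpartition * overpartition) :=
  [set lm | let: (la, mu) := lm in
    [/\ [/\ op_weight la + op_weight mu = n,
            size la + size mu = m,
            count (fun p => p.2) la + count (fun p => ~~ p.2) mu = s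
          & size mu = t],
        valuation 1 la mu <= i - 1
      & forall j, 1 <= j -> freq j la + valuation j.+1 la mu <= k - 1]%N].

(* Main.v *)
From HB Require Import structures.
Require Import Defs.
From mathcomp Require Import all_boot all_order all_algebra.
From mathcomp Require Import boolp classical_sets functions cardinality.
From mathcomp Require Import ring zify.

(* Write R_i(y) for the series at x = y.  Splitting off the parts of size 1 and
   sorting by v_1 = m shows that the generating functions of the pairs satisfy
     R_1(x) = R_k(xq),
     R_{m+1}(x) - R_m(x) = (xq)^m / (1 - abxq)
       * (R_{k-m}(xq) + (a + b) R_{k-m+1}(xq) + ab R_{k-m+2}(xq))   (1 <= m < k)
   where R_{k+1} = R_k.  The defining series satisfy the same recurrences: in each of
   them the difference of the two sides telescopes.  Since R_i(x q^N) = 1 modulo q^N,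
   the recurrences determine R_i(x) modulo any power of q as a finite sum over the
   multiplicities of the parts of size at most N. *)

Set Implicit Arguments.
Unset Strict Implicit.
Unset Printing Implicit Defensive.

Import GRing.Theory.

Local Open Scope ring_scope.

(** * Formal power series modulo a power of the variable *)

(** Two features of the defining series shape the proof. Its summands divide by [a] and [b], but a^n
    (-1/a;q)_n is the product of the a + q^j for j < n; once this is absorbed, the normalized series
    [Rser] involves no inverse of [a] or [b], and the recurrences are proved for it. Moreover,
    replacing y by yq merely multiplies one factor V_n of the summand by q^(n(K+1)) and shifts the
    other factor h_n to h_(n+1). Both sides of a recurrence thus involve the same V_n, h_n and
    h_(n+1), and a first-order recurrence for each factor turns the telescoping into identities that
    [ring] checks. On the combinatorial side, the condition on size j+1 sees size j only through
    f_j(lambda), and the possible overlinings of one size contribute 1, a + b and ab. The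
    multiplicity of j in mu is not bounded by the valuation. It produces the geometric factor 1/(1 -
    abxq), which is truncated at exponent B with an error divisible by q^B. *)

Definition fps_eqmod (R : Type) (M : nat) (f g : {fps R}) :=
  forall n, (n < M)%N -> f n = g n.

Section EqmodRing.
Variable R : comNzRingType.
Implicit Types f g : {fps R}.
Local Notation q := (fps_var : {fps R}).

Lemma coef_fps0 n : (0 : {fps R}) n = 0.
Proof. by case: n. Qed.

Lemma coef_fpsD f g n : (f + g) n = f n + g n.
Proof. by []. Qed.

Lemma coef_fpsN f n : (- f) n = - f n.
Proof. by []. Qed.

Lemma coef_fpsM f g n : (f * g) n = \sum_(j < n.+1) f j * g (n - j)%N.
Proof. by []. Qed.

Lemma coef_fps_sum I (r : seq I) (P : pred I) (F : I -> {fps R}) n :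
  (\sum_(i <- r | P i) F i) n = \sum_(i <- r | P i) F i n.
Proof.
by apply: (big_morph (fun f : {fps R} => f n)) => [f g|]; rewrite ?coef_fps0.
Qed.

Lemma fps_eqmod_sym M f g : fps_eqmod M f g -> fps_eqmod M g f.
Proof. by move=> fg n /fg. Qed.

Lemma fps_eqmod_trans M f g h :
  fps_eqmod M f g -> fps_eqmod M g h -> fps_eqmod M f h.
Proof. by move=> fg gh n ltnM; rewrite fg ?gh. Qed.

Lemma fps_eqmod_le M N f g : (M <= N)%N -> fps_eqmod N f g -> fps_eqmod M f g.
Proof. by move=> leMN fg n ltnM; apply/fg/(leq_trans ltnM). Qed.

Lemma fps_eqmodD M f1 g1 f2 g2 :
  fps_eqmod M f1 g1 -> fps_eqmod M f2 g2 -> fps_eqmod M (f1 + f2) (g1 + g2).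
Proof. by move=> e1 e2 n ltnM; rewrite !coef_fpsD e1 ?e2. Qed.

Lemma fps_eqmodN M f g : fps_eqmod M f g -> fps_eqmod M (- f) (- g).
Proof. by move=> e n ltnM; rewrite !coef_fpsN e. Qed.

Lemma fps_eqmodM M f1 g1 f2 g2 :
  fps_eqmod M f1 g1 -> fps_eqmod M f2 g2 -> fps_eqmod M (f1 * f2) (g1 * g2).
Proof.
move=> e1 e2 n ltnM; rewrite !coef_fpsM; apply: eq_bigr => -[j /= ltjn] _.
by rewrite e1 ?e2 ?(leq_ltn_trans (leq_subr _ _)) ?(leq_ltn_trans _ ltnM).
Qed.

Lemma fps_eqmod_sum M I (r : seq I) (P : pred I) (F G : I -> {fps R}) :
  (forall i, P i -> fps_eqmod M (F i) (G i)) ->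
  fps_eqmod M (\sum_(i <- r | P i) F i) (\sum_(i <- r | P i) G i).
Proof.
by move=> e n ltnM; rewrite !coef_fps_sum; apply: eq_bigr => i /e ->.
Qed.

Lemma fps_eqmod_eq f g : (forall M, fps_eqmod M f g) -> f = g.
Proof. by move=> e; apply/fpsP => n; apply: (e n.+1). Qed.

Lemma coef_fps_varXM M f n : (q ^+ M * f) n = if (n < M)%N then 0 else f (n - M)%N.
Proof.
elim: M n => [|M IHM] n; first by rewrite expr0 mul1r subn0.
have varM (g : {fps R}) j : (q * g) j = if j is j'.+1 then g j' else 0.
  rewrite coef_fpsM; case: j => [|j]; first by rewrite big_ord1 mul0r.
  rewrite big_ord_recl mul0r add0r big_ord_recl mul1r subSS subn0.
  by rewrite big1 ?addr0 // => l _; rewrite mul0r.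
by rewrite exprS -mulrA varM; case: n => // n; rewrite IHM ltnS subSS.
Qed.

Lemma fps_eqmod_varXM M N f : (M <= N)%N -> fps_eqmod M (q ^+ N * f) 0.
Proof.
by move=> leMN n ltnM; rewrite coef_fps_varXM (leq_trans ltnM leMN) coef_fps0.
Qed.

Lemma fps_eqmod0M M f g : fps_eqmod M f 0 -> fps_eqmod M (f * g) 0.
Proof. by move=> f0; rewrite -(mul0r g); apply: fps_eqmodM. Qed.

Lemma fps_eqmod0Z M c f : fps_eqmod M f 0 -> fps_eqmod M (c * f) 0.
Proof. by rewrite mulrC; apply: fps_eqmod0M. Qed.

(** Fixing the rate of decay makes the first [M] terms determine the sum modulo q^M. *)
Definition fps_summable (u : nat -> {fps R}) := forall n, fps_eqmod n (u n) 0.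

Lemma fps_summableD u v :
  fps_summable u -> fps_summable v -> fps_summable (fun n => u n + v n).
Proof. by move=> u0 v0 n; rewrite -[0](addr0 0); apply: fps_eqmodD. Qed.

Lemma fps_summableZ c u : fps_summable u -> fps_summable (fun n => c * u n).
Proof. by move=> u0 n; apply: fps_eqmod0Z. Qed.

Lemma fps_eqmod_lim M (u : nat -> {fps R}) :
  (forall n, (M <= n)%N -> fps_eqmod M (u n) (u M)) -> fps_eqmod M (fps_lim u) (u M).
Proof. by move=> uM n ltnM; apply: fps_limE; exists M => N /uM; apply. Qed.

Lemma fps_eqmod_fps_sum M (u : nat -> {fps R}) :
  fps_summable u -> fps_eqmod M (fps_sum u) (\sum_(n < M) u n).
Proof.
move=> u0; apply: (@fps_eqmod_lim M (fun N => \sum_(n < N) u n)) => N leMN.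
rewrite -(subnKC leMN) big_split_ord /= -[X in fps_eqmod _ _ X]addr0.
apply: fps_eqmodD => //; apply: fps_eqmod_trans (_ : fps_eqmod _ _ (\sum_(j < N - M) 0)) _.
  by apply: fps_eqmod_sum => j _; apply/fps_eqmod_le/u0/leq_addr.
by rewrite big1.
Qed.

Lemma fps_eqmod_qpoch M z n :
  (M <= n)%N -> fps_eqmod M (qpoch z q n) (qpoch z q M).
Proof.
move=> leMn; rewrite -(subnKC leMn) /qpoch big_split_ord /=.
rewrite -[X in fps_eqmod _ _ X]mulr1; apply: fps_eqmodM => //.
rewrite /qpoch; elim/big_rec: _ => // j f _ f1; rewrite -[X in fps_eqmod _ _ X]mulr1; apply: fps_eqmodM => //.
rewrite -[X in fps_eqmod _ _ X]subr0; apply: fps_eqmodD => //; apply: fps_eqmodN.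
by rewrite mulrC; apply/fps_eqmod_varXM/leq_addr.
Qed.

Lemma fps_eqmod_qpoch_inf M z : fps_eqmod M (qpoch_inf z q) (qpoch z q M).
Proof. by apply: fps_eqmod_lim => n; apply: fps_eqmod_qpoch. Qed.

Lemma qpoch_recl z n : qpoch z q n.+1 = (1 - z) * qpoch (z * q) q n.
Proof.
rewrite /qpoch big_ord_recl expr0 mulr1; congr (_ * _).
by apply: eq_bigr => j _; rewrite /bump /= exprS mulrA.
Qed.

Lemma qpoch_inf_rec z : qpoch_inf z q = (1 - z) * qpoch_inf (z * q) q.
Proof.
apply: fps_eqmod_eq => M.
apply: fps_eqmod_trans (fps_eqmod_le (leqnSn M) (fps_eqmod_qpoch_inf (M := M.+1) _)) _.
rewrite qpoch_recl; apply: fps_eqmodM => //.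
exact/fps_eqmod_sym/fps_eqmod_qpoch_inf.
Qed.

Lemma qpoch_inf_split z n : qpoch_inf z q = qpoch z q n * qpoch_inf (z * q ^+ n) q.
Proof.
elim: n => [|n IHn]; first by rewrite /qpoch big_ord0 mul1r mulr1.
have -> : qpoch z q n.+1 = qpoch z q n * (1 - z * q ^+ n) by apply: big_ord_recr.
have -> : qpoch_inf (z * q ^+ n.+1) q = qpoch_inf (z * q ^+ n * q) q.
  by rewrite exprSr mulrA.
by rewrite -mulrA -[(1 - _) * _]qpoch_inf_rec.
Qed.

Lemma qpoch_inf_eqmod1 M z : fps_eqmod M z 0 -> fps_eqmod M (qpoch_inf z q) 1.
Proof.
move=> z0; apply: fps_eqmod_trans (fps_eqmod_qpoch_inf _) _.
rewrite /qpoch; elim/big_rec: _ => // j f _ f1; rewrite -[X in fps_eqmod _ _ X]mulr1; apply: fps_eqmodM => //.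
rewrite -[X in fps_eqmod _ _ X]subr0; apply: fps_eqmodD => //; apply: fps_eqmodN.
exact: fps_eqmod0M.
Qed.

(** Since [p 0] is zero, the partial sums of length [M] differ by [p M] alone, which vanishes modulo
    q^M. *)
Lemma fps_sum_telescope (u v p : nat -> {fps R}) :
  fps_summable u -> fps_summable v ->
  fps_summable p -> p 0%N = 0 ->
  (forall n, u n - p n = v n - p n.+1) -> fps_sum u = fps_sum v.
Proof.
move=> u0 v0 p0 p00 uvp; apply: fps_eqmod_eq => M.
apply: fps_eqmod_trans (fps_eqmod_fps_sum (M := M) u0) _.
apply: fps_eqmod_trans (fps_eqmod_sym (fps_eqmod_fps_sum (M := M) v0)).
have -> : \sum_(n < M) u n = \sum_(n < M) v n - p M.
  elim: M => [|M IHM]; first by rewrite !big_ord0 p00 subr0.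
  rewrite !big_ord_recr /= IHM -addrA [- p M + _]addrC uvp; ring.
rewrite -[X in fps_eqmod _ _ X]subr0; apply: fps_eqmodD => //.
exact/fps_eqmodN.
Qed.

Lemma fps_sumD (u v : nat -> {fps R}) :
  fps_summable u -> fps_summable v ->
  fps_sum (fun n => u n + v n) = fps_sum u + fps_sum v.
Proof.
move=> u0 v0; apply: fps_eqmod_eq => M.
apply: (@fps_eqmod_trans _ _ (\sum_(n < M) (u n + v n))).
  exact/fps_eqmod_fps_sum/fps_summableD.
by rewrite big_split; apply: fps_eqmodD; apply/fps_eqmod_sym/fps_eqmod_fps_sum.
Qed.

Lemma fps_sumZ c (u : nat -> {fps R}) :
  fps_summable u -> fps_sum (fun n => c * u n) = c * fps_sum u.
Proof.
move=> u0; apply: fps_eqmod_eq => M.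
apply: (@fps_eqmod_trans _ _ (\sum_(n < M) (c * u n))).
  exact/fps_eqmod_fps_sum/fps_summableZ.
by rewrite -mulr_sumr; apply: fps_eqmodM => //; apply/fps_eqmod_sym/fps_eqmod_fps_sum.
Qed.

Lemma fps_sumB u v : fps_summable u -> fps_summable v ->
  fps_sum (fun n => u n + (-1) * v n) = fps_sum u - fps_sum v.
Proof.
by move=> u0 v0; rewrite (fps_sumD u0 (fps_summableZ (-1) v0)) (fps_sumZ _ v0) mulN1r.
Qed.

Lemma fps_sum_lin3 c d e u v w :
  fps_summable u -> fps_summable v -> fps_summable w ->
  fps_sum (fun n => c * (u n + d * v n + e * w n))
  = c * (fps_sum u + d * fps_sum v + e * fps_sum w).
Proof.
move=> u0 v0 w0; have uv0 := fps_summableD u0 (fps_summableZ d v0).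
rewrite (fps_sumZ c (fps_summableD uv0 (fps_summableZ e w0))).
rewrite (fps_sumD uv0 (fps_summableZ e w0)) (fps_sumD u0 (fps_summableZ d v0)).
by rewrite (fps_sumZ d v0) (fps_sumZ e w0).
Qed.

Lemma fps_summable_lin3 c d e u v w :
  fps_summable u -> fps_summable v -> fps_summable w ->
  fps_summable (fun n => c * (u n + d * v n + e * w n)).
Proof.
move=> u0 v0 w0; apply: fps_summableZ; apply: fps_summableD; last exact: fps_summableZ.
by apply: fps_summableD; last exact: fps_summableZ.
Qed.

End EqmodRing.

Lemma fps_eqmod1_unit (R : comUnitRingType) M (f : {fps R}) :
  (0 < M)%N -> fps_eqmod M f 1 -> f \is a GRing.unit.
Proof. move=> M_gt0 f1; suff: f 0%N \is a GRing.unit by [].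
by rewrite f1 // unitr1. Qed.

(** * The recurrences *)

Section Summands.
Variables (A : comUnitRingType) (a b q : A).

(* [K] stands for [k - 1], and [j] for [i - 1]: the series [R_{k,i}(y)] multiplied
   by [(abyq)_oo] has summands [V_n h_n q^((k-j)n) (X_n - yq (y q^(2n+1))^j Y_n)]. *)
Definition facX (y : A) n := (1 + a * y * q ^+ n.+1) * (1 + b * y * q ^+ n.+1).
Definition facY n := (a + q ^+ n) * (b + q ^+ n).
Definition summand K (V h : nat -> A) j y n :=
  V n * h n * (q ^+ n) ^+ (K.+1 - j)
  * (facX y n - y * q * (y * q * q ^+ n * q ^+ n) ^+ j * facY n).

(** The primed sequences are [V] and [h] with [y] replaced by [y * q]. These four hypotheses are all
    that the telescoping uses. *)
Variables (K : nat) (y : A) (V h V' h' : nat -> A).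
Hypothesis V_rec : forall n, (1 - q ^+ n.+1) * V n.+1
  = - (V n * facY n * y * q ^+ n.+1 * (y * q * q ^+ n * q ^+ n) ^+ K).
Hypothesis h_rec : forall n, (1 - y * q ^+ n.+1) * h n = facX y n.+1 * h n.+1.
Hypothesis V'E : forall n, V' n = V n * (q ^+ n) ^+ K.+1.
Hypothesis h'E : forall n, h' n = h n.+1.

Local Notation t := (summand K V h).
Local Notation t' j := (summand K V' h' j (y * q)).

(** The telescoping certificate. The factor [1 - q ^+ n] kills it at 0 and lets [V_rec] replace
    V_(n+1) by V_n; the factor [facX y n] likewise lets [h_rec] replace h_(n+1) by h_n. *)
Definition telescoper m n := V n * (1 - q ^+ n) * h n * facX y n * (q ^+ n) ^+ (K.+1 - m).

Lemma telescoper0 m : telescoper m 0 = 0.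
Proof. by rewrite /telescoper expr0 subrr mulr0 !mul0r. Qed.

Lemma facX_shift n : facX (y * q) n = facX y n.+1.
Proof. by rewrite /facX !exprS; ring. Qed.

Lemma telescoperS m n : telescoper m n.+1
  = - (V n * facY n * y * q ^+ n.+1 * (y * q * q ^+ n * q ^+ n) ^+ K)
    * ((1 - y * q ^+ n.+1) * h n) * (q ^+ n.+1) ^+ (K.+1 - m).
Proof. by rewrite h_rec -V_rec /telescoper; ring. Qed.

(** Put Q = q^n and w = y q^(n+2). The weights 1, a + b, ab act twice on the right: on the [facX]
    parts they assemble Q^2 + (a + b) Q + ab = [facY n], on the [facY] parts 1 + (a + b) w + ab w^2
    = [facX y n.+1]. So the product of both factors comes out, and h_(n+1) occurs only in
    [facX y n.+1 * h n.+1]. *)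
Lemma summand_rec m n : (m < K)%N ->
  t m.+1 y n - t m y n - telescoper m.+1 n
  = (y * q) ^+ m.+1 * (t' (K - m.+1)%N n + (a + b) * t' (K - m.+1).+1 n
                       + a * b * t' (K - m.+1).+2 n) - telescoper m.+1 n.+1.
Proof.
move=> ltmK; rewrite telescoperS /telescoper /summand h'E V'E facX_shift.
(* With [r] for K - m - 1, all truncated subtractions in the exponents disappear. *)
have [r defK] : exists r, K = (m + r).+1 by exists (K - m.+1)%N; lia.
have -> : (K - m.+1 = r)%N by lia.
have -> : (K.+1 - m.+1 = r.+1)%N by lia.
have -> : (K.+1 - m = r.+2)%N by lia.
have -> : (K.+1 - r = m.+2)%N by lia.
have -> : (K.+1 - r.+1 = m.+1)%N by lia.
have -> : (K.+1 - r.+2 = m)%N by lia.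
have := h_rec n; have -> : facX y n.+1
    = (1 + (a + b) * (y * q * q * q ^+ n) + a * b * (y * q * q * q ^+ n) ^+ 2).
  by rewrite /facX !exprS; ring.
rewrite /facX /facY defK (exprS q n); move: (q ^+ n) (h n) (h n.+1) (V n) => Q hn h1 Vn hrec.
set X1 := (1 + _ + _) in hrec *.
(* The factored right-hand side; [hrec] then eliminates [h1]. *)
rewrite [X in _ = X - _](_ : _
  = X1 * h1 * ((y * q) ^+ m.+1 * Vn * Q ^+ (m + m + r).+2 * ((a + Q) * (b + Q))
      * (1 - (y * q * q * Q * Q) ^+ r.+1))); last first.
  by rewrite /X1 !exprS !(exprD, exprMn); ring.
rewrite -hrec !exprS !(exprD, exprMn); ring.
Qed.

Lemma summand_top n : t K.+1 y n - t K y n - telescoper K.+1 n = - telescoper K.+1 n.+1.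
Proof.
rewrite telescoperS /telescoper /summand /facX /facY.
by rewrite subnn subSnn !exprS; ring.
Qed.

(** For j = 0 the last factor of the summand splits: [facX y n - y * q * facY n] equals (1 - abyq)(1
    - y q^(2n+1)). This is where the common factor 1 - abyq comes from. *)
Lemma summand_base n :
  t 0 y n - (1 - a * b * y * q) * (V n * h n * (q ^+ n) ^+ K.+1 * (1 - q ^+ n))
  = (1 - a * b * y * q) * t' K n
    - (1 - a * b * y * q) * (V n.+1 * h n.+1 * (q ^+ n.+1) ^+ K.+1 * (1 - q ^+ n.+1)).
Proof.
have -> : V n.+1 * h n.+1 * (q ^+ n.+1) ^+ K.+1 * (1 - q ^+ n.+1)
  = ((1 - q ^+ n.+1) * V n.+1) * h n.+1 * (q ^+ n.+1) ^+ K.+1 by ring.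
rewrite V_rec /summand h'E V'E facX_shift subSnn subn0.
(* Isolates [facX y n.+1 * h n.+1], the form to which [h_rec] applies. *)
have -> : V n * (q ^+ n) ^+ K.+1 * h n.+1 * q ^+ n ^+ 1 * (facX y n.+1 -
   y * q * q * (y * q * q * q ^+ n * q ^+ n) ^+ K * facY n) =
   V n * (q ^+ n) ^+ K.+1 * q ^+ n ^+ 1 * (facX y n.+1 * h n.+1 -
   y * q * q * (y * q * q * q ^+ n * q ^+ n) ^+ K * facY n * h n.+1) by ring.
by rewrite -h_rec /facX /facY !exprS; move: (q ^+ n) => Q; rewrite !exprMn; ring.
Qed.

End Summands.

(** Defined by its recurrence, which is what telescoping needs; [vcoef_qpoch] gives the closed
    form. *)
Fixpoint vcoef (A : comUnitRingType) (a b q : A) K y n : A :=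
  if n is n'.+1 then
    - (vcoef a b q K y n' * facY a b q n' * y * q ^+ n
       * (y * q * q ^+ n' * q ^+ n') ^+ K) / (1 - q ^+ n)
  else 1.

(** * Closed form of the coefficients and clearing of denominators *)

Section Normalize.
Variables (A : comUnitRingType) (a b q : A).

Lemma prod_addX n : a \is a GRing.unit ->
  \prod_(j < n) (a + q ^+ j) = a ^+ n * qpoch (- a^-1) q n.
Proof.
move=> Ua; rewrite /qpoch -[in a ^+ n](card_ord n) -prodr_const -big_split.
by apply: eq_bigr => j _; rewrite /= mulrBr mulr1 mulrA mulrN divrr // mulN1r opprK.
Qed.

Lemma vcoef_rec K y n : 1 - q ^+ n.+1 \is a GRing.unit ->
  (1 - q ^+ n.+1) * vcoef a b q K y n.+1
  = - (vcoef a b q K y n * facY a b q n * y * q ^+ n.+1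
       * (y * q * q ^+ n * q ^+ n) ^+ K).
Proof. by move=> Uq; rewrite mulrC divrK. Qed.

Lemma vcoef_qpoch K y n : (forall j, 1 - q ^+ j.+1 \is a GRing.unit) ->
  vcoef a b q K y n * qpoch q q n
  = (- 1) ^+ n * \prod_(j < n) facY a b q j * y ^+ n * q ^+ 'C(n.+1, 2)
    * (y ^+ n * q ^+ (n ^ 2)) ^+ K.
Proof.
move=> Uq; elim: n => [|n IHn].
  by rewrite /qpoch !big_ord0 !expr0 !mul1r expr1n.
have -> : qpoch q q n.+1 = qpoch q q n * (1 - q ^+ n.+1).
  by rewrite /qpoch big_ord_recr /= exprS.
rewrite [LHS](_ : _ = (1 - q ^+ n.+1) * vcoef a b q K y n.+1 * qpoch q q n); last by ring.
have -> : \prod_(j < n.+1) facY a b q j = \prod_(j < n) facY a b q j * facY a b q n.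
  exact: big_ord_recr.
rewrite vcoef_rec //.
set v := vcoef _ _ _ _ _ _ in IHn *.
rewrite [LHS](_ : _ = - (v * qpoch q q n) * facY a b q n * y * q ^+ n.+1 *
  (y * q * q ^+ n * q ^+ n) ^+ K); last by ring.
have -> : (n.+1 ^ 2 = (n ^ 2 + n + n).+1)%N by nia.
rewrite IHn (binS n.+1) bin1; move: 'C(n.+1, 2) (n ^ 2)%N (\prod_(j < n) _) => c d P.
by rewrite !exprS !(exprD, exprMn) !exprS; ring.
Qed.

(** Turns the exponent n^2 - C(n,2) of the defining series into C(n+1,2), free of subtraction. *)
Lemma bin2_square n : ('C(n.+1, 2) + 'C(n, 2) = n ^ 2)%N.
Proof.
by elim: n => // n IHn; rewrite (binS n.+1) (binS n) !bin1 in IHn *; nia.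
Qed.


(** Here [Px], [Pq], [Pa], [Pb] stand for the finite products (xq)_n, (q)_n, (-axq)_n, (-bxq)_n;
    [Xa], [Xb] for the next factors 1 + axq^(n+1) and 1 + bxq^(n+1); [Ex], [Ea], [Eb] for the
    remaining infinite tails. *)
Lemma normalize_algebra (N0 N1 Px Pq Pa Pb Xa Xb Ex Ea Eb C w V : A) :
  Pq \is a GRing.unit -> Pa \is a GRing.unit -> Pb \is a GRing.unit ->
  Xa \is a GRing.unit -> Xb \is a GRing.unit -> Ex \is a GRing.unit ->
  Ea \is a GRing.unit -> Eb \is a GRing.unit ->
  V * Pq = N1 -> N0 = N1 * w ->
  N0 * Px / (Pq * Pa * Pb) * (1 - C / (Xa * Xb))
  = (Px * Ex) / (Pa * Xa * Ea * (Pb * Xb * Eb)) * (V * (Ea * Eb / Ex) * w * (Xa * Xb - C)).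
Proof.
move=> UPq UPa UPb UXa UXb UEx UEa UEb <- ->.
have UX : Xa * Xb \is a GRing.unit by rewrite unitrM UXa.
have -> : 1 - C / (Xa * Xb) = (Xa * Xb - C) / (Xa * Xb) by rewrite mulrBl divrr.
have -> : (Pq * Pa * Pb)^-1 = Pq^-1 * (Pa^-1 * Pb^-1).
  by rewrite !invrM ?unitrM ?UPq ?UPa //; ring.
rewrite [(_ * _ * _ * (Pb * _ * _))^-1](_ : _
  = (Xa * Xb)^-1 * (Pa^-1 * Pb^-1) * (Ea^-1 * Eb^-1)); last first.
  by rewrite !invrM ?unitrM ?UPa ?UXa ?UEa ?UPb ?UXb ?UEb //; ring.
transitivity (V * w * Px * (Pa^-1 * Pb^-1) * ((Xa * Xb - C) / (Xa * Xb))
  * (Pq / Pq)); first ring.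
transitivity (V * w * Px * (Pa^-1 * Pb^-1) * ((Xa * Xb - C) / (Xa * Xb))
  * (Ex / Ex) * (Ea / Ea) * (Eb / Eb)); last ring.
by rewrite !divrr // !mulr1.
Qed.

End Normalize.

Section Shift.
(** [E] plays z -> (z;q)_oo; its functional equation and the invertibility of the values [E (z * q)]
    suffice. *)
Variables (A : comUnitRingType) (E : A -> A) (a b q : A).
Hypothesis E_rec : forall z, E z = (1 - z) * E (z * q).
Hypothesis E_unit : forall z, E (z * q) \is a GRing.unit.
Hypothesis q_unit : forall y n, 1 - y * q ^+ n.+1 \is a GRing.unit.

(** The infinite products left after cancelling the finite ones. The numerators start at q^(n+2),
    one step later than the denominator, because the 1 + axq^(n+1) and 1 + bxq^(n+1) under the
    subtracted fraction are cleared as well. *)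
Definition hcoef y n :=
  E (- a * y * q ^+ n.+2) * E (- b * y * q ^+ n.+2) / E (y * q ^+ n.+1).

Lemma hcoef_rec y n : (1 - y * q ^+ n.+1) * hcoef y n = facX a b q y n.+1 * hcoef y n.+1.
Proof.
have Uh : E (y * q ^+ n.+2) \is a GRing.unit by rewrite exprSr mulrA E_unit.
rewrite /hcoef /facX [E (- a * y * q ^+ n.+2)]E_rec [E (- b * y * q ^+ n.+2)]E_rec.
rewrite [E (y * q ^+ n.+1)]E_rec -!(mulrA _ (q ^+ _) q) -!exprSr.
rewrite invrM // !mulNr !opprK.
set E1 := E (- _); set E2 := E (- _); set E3 := E _.
transitivity ((1 - y * q ^+ n.+1) / (1 - y * q ^+ n.+1)
  * ((1 + a * y * q ^+ n.+2) * (1 + b * y * q ^+ n.+2) * (E1 * E2 / E3))); first by ring.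
by rewrite divrr // mul1r.
Qed.

Lemma hcoef_shift y n : hcoef (y * q) n = hcoef y n.+1.
Proof. by rewrite /hcoef !mulrA -!(mulrA _ q (q ^+ _)) -!exprS. Qed.

Lemma vcoef_shift K y n :
  vcoef a b q K (y * q) n = vcoef a b q K y n * (q ^+ n) ^+ K.+1.
Proof.
elim: n => [|n IHn]; first by rewrite expr0 expr1n mulr1.
have U : 1 - q ^+ n.+1 \is a GRing.unit by rewrite -(mul1r (q ^+ _)).
apply: (mulrI U); rewrite [RHS]mulrA !vcoef_rec // IHn !exprS.
by move: (q ^+ n) => Q; rewrite !exprMn; ring.
Qed.

(** The source of summability for the summands and for the certificates. *)
Lemma vcoef_divX K y n : exists c, vcoef a b q K y n = q ^+ n * c.
Proof.
case: n => [|n]; first by exists 1; rewrite mulr1.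
have U : 1 - q ^+ n.+1 \is a GRing.unit by rewrite -(mul1r (q ^+ _)).
exists (- ((1 - q ^+ n.+1)^-1 * vcoef a b q K y n * facY a b q n * y
           * (y * q * q ^+ n * q ^+ n) ^+ K)).
by rewrite -[LHS](mulKr U) vcoef_rec //; ring.
Qed.

End Shift.

(** * The recurrences for the normalized series *)

Section Series.
Variables (R : comUnitRingType) (a b : {fps R}).
Local Notation q := (fps_var : {fps R}).
Implicit Types y : {fps R}.

Lemma qpoch_inf_unit y : qpoch_inf (y * q) q \is a GRing.unit.
Proof.
apply: (@fps_eqmod1_unit _ 1) => //; apply: qpoch_inf_eqmod1.
by rewrite mulrC -[q]expr1; apply: fps_eqmod_varXM.
Qed.

Lemma unit_1subXn y n : 1 - y * q ^+ n.+1 \is a GRing.unit.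
Proof.
apply: (@fps_eqmod1_unit _ 1) => //.
rewrite -[X in fps_eqmod _ _ X]subr0; apply: fps_eqmodD => //; apply: fps_eqmodN.
by rewrite mulrC; apply: fps_eqmod_varXM.
Qed.

Lemma qpoch_unit y n : qpoch (y * q) q n \is a GRing.unit.
Proof.
rewrite /qpoch; elim/big_rec: _ => [|j f _ Uf]; first exact: unitr1.
by rewrite unitrM Uf -mulrA -exprS unit_1subXn.
Qed.

Definition Ssummand K j y :=
  summand a b q K (vcoef a b q K y) (hcoef (fun z => qpoch_inf z q) a b q y) j y.
Definition Sser K j y := fps_sum (Ssummand K j y).
Definition Rser K j y := Sser K j y / qpoch_inf (a * b * y * q) q.

Let V_rec K y n : (1 - q ^+ n.+1) * vcoef a b q K y n.+1
  = - (vcoef a b q K y n * facY a b q n * y * q ^+ n.+1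
       * (y * q * q ^+ n * q ^+ n) ^+ K).
Proof. by apply: vcoef_rec; rewrite -(mul1r (q ^+ _)) unit_1subXn. Qed.

Let h_rec := hcoef_rec a b (@qpoch_inf_rec R) qpoch_inf_unit unit_1subXn.
Let h_shift y n : hcoef (fun z => qpoch_inf z q) a b q (y * q) n
                = hcoef (fun z => qpoch_inf z q) a b q y n.+1.
Proof. exact: hcoef_shift. Qed.
Let V_shift := vcoef_shift a b unit_1subXn.

Lemma vcoef_summable K y : fps_summable (vcoef a b q K y).
Proof.
move=> n; have [c ->] := vcoef_divX a b unit_1subXn K y n.
exact: fps_eqmod_varXM.
Qed.

Lemma Ssummand_summable K j y : fps_summable (Ssummand K j y).
Proof. by move=> n; rewrite /Ssummand /summand -!mulrA; apply/fps_eqmod0M/vcoef_summable. Qed.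

Let p K y j n := telescoper a b q K y (vcoef a b q K y)
  (hcoef (fun z => qpoch_inf z q) a b q y) j n.

Let p_summable K y j : fps_summable (p K y j).
Proof. by move=> n; rewrite /p /telescoper -!mulrA; apply/fps_eqmod0M/vcoef_summable. Qed.

Let p0 K y j : p K y j 0 = 0.
Proof. exact: telescoper0. Qed.

Let SB_summable K i j y : fps_summable (fun n => Ssummand K i y n + (-1) * Ssummand K j y n).
Proof. exact/fps_summableD/fps_summableZ/Ssummand_summable/Ssummand_summable. Qed.

Lemma SserB K i j y :
  fps_sum (fun n => Ssummand K i y n + (-1) * Ssummand K j y n) = Sser K i y - Sser K j y.
Proof. exact: (fps_sumB (Ssummand_summable K i y) (Ssummand_summable K j y)). Qed.

Lemma Sser_rec K m y : (m < K)%N ->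
  Sser K m.+1 y - Sser K m y
    = (y * q) ^+ m.+1 * (Sser K (K - m.+1) (y * q) + (a + b) * Sser K (K - m.+1).+1 (y * q)
                         + a * b * Sser K (K - m.+1).+2 (y * q)).
Proof.
move=> ltmK; have S0 := Ssummand_summable K.
apply: (etrans (esym (SserB K m.+1 m y))).
apply: (etrans _ (fps_sum_lin3 _ _ _ (S0 _ _) (S0 _ _) (S0 _ _))).
apply: (fps_sum_telescope (SB_summable K m.+1 m y)
  (fps_summable_lin3 _ _ _ (S0 _ _) (S0 _ _) (S0 _ _))
  (p_summable K y m.+1) (p0 K y m.+1)) => n.
rewrite mulN1r; exact: (summand_rec (V_rec K y) (h_rec y) (V_shift K y) (h_shift y) n ltmK).
Qed.

Lemma Sser_top K y : Sser K K.+1 y = Sser K K y.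
Proof.
have S0 := Ssummand_summable K.
apply: subr0_eq; apply: (etrans (esym (SserB K K.+1 K y))).
(* Zero is written as the sum of 0 times a summable sequence, to serve as the second series of the
   telescoping. *)
apply: (etrans _ (mul0r (Sser K K y))); apply: (etrans _ (fps_sumZ 0 (S0 K y))).
apply: (fps_sum_telescope (SB_summable K K.+1 K y) (fps_summableZ 0 (S0 K y))
  (p_summable K y K.+1) (p0 K y K.+1)) => n.
rewrite mulN1r mul0r add0r; exact: (summand_top (V_rec K y) (h_rec y) n).
Qed.

Lemma Sser_base K y : Sser K 0 y = (1 - a * b * y * q) * Sser K K (y * q).
Proof.
have S0 := Ssummand_summable K.
apply: (etrans _ (fps_sumZ _ (S0 K (y * q)))).
pose h := hcoef (fun z => qpoch_inf z q) a b q y.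
apply: (fps_sum_telescope (S0 0%N y) (fps_summableZ _ (S0 K (y * q)))
  (p := fun n => (1 - a * b * y * q)
    * (vcoef a b q K y n * h n * (q ^+ n) ^+ K.+1 * (1 - q ^+ n)))) => [n||n].
- by apply: fps_eqmod0Z; rewrite -!mulrA; apply/fps_eqmod0M/vcoef_summable.
- by rewrite expr0 subrr !mulr0.
- exact: (summand_base (V_rec K y) (h_rec y) (V_shift K y) (h_shift y) n).
Qed.

End Series.

Section Algebra.
Variable A : comUnitRingType.

(** Serves to pass from [Sser] to [Rser]: [F] and [E] are the values of (abyq)_oo at [y] and at
    [y * q], with quotient [u] = 1 - abyq. *)
Lemma div_rec (S1 S0 T E F u : A) : F = u * E -> u \is a GRing.unit -> E \is a GRing.unit ->
  S1 - S0 = T -> u * (S1 / F - S0 / F) = T / E.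
Proof.
move=> -> Uu UE <-; rewrite -mulrBl invrM // mulrCA; congr (_ * _).
by rewrite mulrCA divrr // mulr1.
Qed.

Lemma div_base (S T E F u : A) : F = u * E -> u \is a GRing.unit -> E \is a GRing.unit ->
  S = u * T -> S / F = T / E.
Proof. 
move=> -> Uu UE ->; rewrite invrM //.
transitivity (T / E * (u / u)); first by ring.
by rewrite divrr // mulr1.
Qed.

Lemma lin3_div (c d e u v w E : A) :
  c * (u + d * v + e * w) / E = c * (u / E + d * (v / E) + e * (w / E)).
Proof. by ring. Qed.

End Algebra.

Section Rec.
Variables (R : comUnitRingType) (a b : {fps R}).
Local Notation q := (fps_var : {fps R}).
Implicit Types y : {fps R}.

Let Eq y : qpoch_inf (a * b * y * q) q
  = (1 - a * b * y * q) * qpoch_inf (a * b * (y * q) * q) q.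
Proof. by rewrite qpoch_inf_rec (mulrA (a * b)). Qed.

Let Uq y : 1 - y * q \is a GRing.unit.
Proof. exact: (unit_1subXn y 0). Qed.

Lemma Rser_rec K m y : (m < K)%N ->
  (1 - a * b * y * q) * (Rser a b K m.+1 y - Rser a b K m y)
    = (y * q) ^+ m.+1 * (Rser a b K (K - m.+1) (y * q)
                         + (a + b) * Rser a b K (K - m.+1).+1 (y * q)
                         + a * b * Rser a b K (K - m.+1).+2 (y * q)).
Proof.
move=> ltmK; apply: (etrans _ (lin3_div _ _ _ _ _ _ _)).
exact: (div_rec (Eq y) (Uq _) (qpoch_inf_unit _) (Sser_rec a b y ltmK)).
Qed.

Lemma Rser_top K y : Rser a b K K.+1 y = Rser a b K K y.
Proof. exact: (congr1 (fun f => f / _) (Sser_top a b K y)). Qed.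

Lemma Rser_base K y : Rser a b K 0 y = Rser a b K K (y * q).
Proof. exact: (div_base (Eq y) (Uq _) (qpoch_inf_unit _) (Sser_base a b K y)). Qed.

Lemma fps_eqmod1V M (f : {fps R}) : f \is a GRing.unit -> fps_eqmod M f 1 -> fps_eqmod M f^-1 1.
Proof.
move=> Uf f1; have e : fps_eqmod M (f^-1 * f) (f^-1 * 1) by apply: fps_eqmodM.
by apply: fps_eqmod_sym; move: e; rewrite mulVr // mulr1.
Qed.

Lemma fps_eqmod11M M (f g : {fps R}) :
  fps_eqmod M f 1 -> fps_eqmod M g 1 -> fps_eqmod M (f * g) 1.
Proof. by move=> f1 g1; rewrite -[1]mulr1; apply: fps_eqmodM. Qed.

Lemma fps_eqmod1D M (f : {fps R}) : fps_eqmod M f 0 -> fps_eqmod M (1 + f) 1.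
Proof. by move=> f0; rewrite -[X in fps_eqmod _ _ X]addr0; apply: fps_eqmodD. Qed.

Lemma vcoefS_eqmod0 M K y n : fps_eqmod M y 0 -> fps_eqmod M (vcoef a b q K y n.+1) 0.
Proof.
move=> y0; have Uqn : 1 - q ^+ n.+1 \is a GRing.unit.
  by rewrite -[X in 1 - X]mul1r unit_1subXn.
rewrite -[vcoef _ _ _ _ _ _](mulKr Uqn) vcoef_rec //; apply: fps_eqmod0Z.
rewrite -[0]oppr0; apply: fps_eqmodN; do 2!apply: fps_eqmod0M.
exact: fps_eqmod0Z.
Qed.

(** Every coefficient V_n with n > 0 contains a factor [y], so only the term n = 0 survives, and
    each of its factors is 1 modulo q^M. *)
Lemma Rser_eqmod1 M K j y : fps_eqmod M y 0 -> fps_eqmod M (Rser a b K j y) 1.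
Proof.
(* Modulo q^0 nothing is claimed; otherwise the truncated sum has a term n = 0 to split off. *)
case: M => // M y0.
have yc c d : fps_eqmod M.+1 (c * y * d) 0 by apply/fps_eqmod0M/fps_eqmod0Z.
have UE d : qpoch_inf (d * q ^+ 1) q \is a GRing.unit by rewrite expr1 qpoch_inf_unit.
apply: fps_eqmod11M; last by apply: fps_eqmod1V; [exact: qpoch_inf_unit | exact/qpoch_inf_eqmod1].
apply: fps_eqmod_trans (fps_eqmod_fps_sum (Ssummand_summable a b K j y)) _.
rewrite big_ord_recl -[X in fps_eqmod _ _ X]addr0; apply: fps_eqmodD; last first.
  apply: (@fps_eqmod_trans _ _ _ (\sum_(n < M) 0)); last by rewrite big1.
  apply: fps_eqmod_sum => n _; rewrite lift0.
  by do 3!apply: fps_eqmod0M; exact: vcoefS_eqmod0.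
rewrite /Ssummand /summand !expr0 expr1n mulr1 mul1r.
apply: fps_eqmod11M.
  apply: fps_eqmod11M; first by apply: fps_eqmod11M; exact: qpoch_inf_eqmod1.
  by apply: fps_eqmod1V; [exact: UE | apply: qpoch_inf_eqmod1; exact: fps_eqmod0M].
rewrite /facX; apply: (@fps_eqmod_trans _ _ _ (1 - 0)); last by rewrite subr0.
apply: fps_eqmodD; first by apply: fps_eqmod11M; exact: fps_eqmod1D.
by apply: fps_eqmodN; rewrite -!mulrA; apply: fps_eqmod0M.
Qed.

End Rec.

(** * Identification of the defining series with the normalized one *)

Section Term.
Variables (A : comUnitRingType) (E : A -> A) (a b q : A).
Hypothesis E_rec : forall z, E z = (1 - z) * E (z * q).
Hypothesis E_unit : forall z, E (z * q) \is a GRing.unit.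
Hypothesis q_unit : forall y n, 1 - y * q ^+ n.+1 \is a GRing.unit.
Hypothesis qpoch_unit : forall y n, qpoch (y * q) q n \is a GRing.unit.
Hypothesis E_split : forall z n, E z = qpoch z q n * E (z * q ^+ n).
Hypotheses (Ua : a \is a GRing.unit) (Ub : b \is a GRing.unit).

(** The powers of [a] and [b] are absorbed into (-1/a)_n and (-1/b)_n by [prod_addX], which leaves
    the product of the [facY]. *)
Lemma term_exponents K j n (x : A) : (j <= K)%N ->
  (- (a * b)) ^+ n * x ^+ (K.+1 * n)
   * q ^+ (K.+1 * n ^ 2 + (K.+1 - j.+1 + 1) * n - 'C(n, 2))
   * (qpoch (- a^-1) q n * qpoch (- b^-1) q n)
  = (- 1) ^+ n * \prod_(j < n) facY a b q j * x ^+ n * q ^+ 'C(n.+1, 2)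
    * (x ^+ n * q ^+ (n ^ 2)) ^+ K * (q ^+ n) ^+ (K.+1 - j).
Proof.
move=> lejK; rewrite big_split /= !prod_addX // [(- (a * b)) ^+ n]exprNn.
have -> : (K.+1 * n ^ 2 + (K.+1 - j.+1 + 1) * n - 'C(n, 2)
           = 'C(n.+1, 2) + n ^ 2 * K + n * (K.+1 - j))%N.
  rewrite mulSn [(K * _)%N]mulnC; have := bin2_square n.
  have -> : (K.+1 - j.+1 + 1 = K.+1 - j)%N by lia.
  by rewrite [(_ * n)%N]mulnC; lia.
rewrite mulSn [(K * n)%N]mulnC.
move: 'C(_, _) (n ^ 2)%N (qpoch _ _ _) (qpoch _ _ _) (K.+1 - j)%N => c d P Q l.
by rewrite !(exprD, exprM, exprMn); ring.
Qed.

Lemma term_factor (x : A) j n :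
  a * b * x ^+ j.+1 * q ^+ ((2 * n + 1) * j.+1 - 2 * n) * (1 + q ^+ n / a) * (1 + q ^+ n / b)
  = x * q * (x * q * q ^+ n * q ^+ n) ^+ j * facY a b q n.
Proof.
have -> : ((2 * n + 1) * j.+1 - 2 * n = 1 + (1 + n + n) * j)%N by nia.
have -> : facY a b q n = (a * (1 + q ^+ n / a)) * (b * (1 + q ^+ n / b)).
  by rewrite /facY !mulrDr !mulr1 ![_ * (_ / _)]mulrC !divrK.
move: (1 + _ / _) (1 + _ / _) => P Q.
rewrite exprD exprM !exprD !expr1 exprS; move: (q ^+ n) => r.
by rewrite !exprMn; ring.
Qed.

Lemma term_normalize K j (x : A) n : (j <= K)%N ->
  ((- (a * b)) ^+ n * x ^+ (K.+1 * n)
       * q ^+ (K.+1 * n ^ 2 + (K.+1 - j.+1 + 1) * n - 'C(n, 2))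
       * (qpoch (- a^-1) q n * qpoch (- b^-1) q n) * qpoch (x * q) q n)
      / (qpoch q q n * qpoch (- a * x * q) q n * qpoch (- b * x * q) q n)
      * (1 - (a * b * x ^+ j.+1 * q ^+ ((2 * n + 1) * j.+1 - 2 * n)
              * (1 + q ^+ n / a) * (1 + q ^+ n / b))
             / ((1 + a * x * q ^+ n.+1) * (1 + b * x * q ^+ n.+1)))
  = E (x * q) / (E (- a * x * q) * E (- b * x * q))
    * summand a b q K (vcoef a b q K x) (hcoef E a b q x) j x n.
Proof.
move=> lejK; rewrite term_factor.
have Uq1 y m : 1 + y * q ^+ m.+1 \is a GRing.unit by rewrite -[y]opprK mulNr.
have UE y m : E (y * q ^+ m.+1) \is a GRing.unit by rewrite exprSr mulrA.
have Ec c : E (- c * x * q)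
    = qpoch (- c * x * q) q n * (1 + c * x * q ^+ n.+1) * E (- c * x * q ^+ n.+2).
  rewrite (E_split _ n) -[RHS]mulrA; congr (_ * _).
  rewrite -(mulrA _ q) -exprS E_rec -(mulrA _ _ q) -exprSr; congr (_ * _).
  by rewrite !mulNr opprK.
have -> : E (x * q) = qpoch (x * q) q n * E (x * q ^+ n.+1).
  by rewrite (E_split _ n) exprS mulrA.
rewrite !Ec.
apply: normalize_algebra; rewrite ?UE ?Uq1 ?qpoch_unit //.
- by rewrite -[X in qpoch X](mul1r q) qpoch_unit.
- by rewrite vcoef_qpoch ?term_exponents // => m; rewrite -[X in 1 - X]mul1r.
Qed.

Lemma prefactor_algebra (Ex Ea Eb Ec S : A) : Ex \is a GRing.unit ->
  Ea \is a GRing.unit -> Eb \is a GRing.unit -> Ec \is a GRing.unit ->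
  Ea * Eb / (Ex * Ec) * (Ex / (Ea * Eb) * S) = S / Ec.
Proof.
move=> Ux UEa UEb Uc; rewrite invrM // mulrA.
transitivity ((Ea * Eb / (Ea * Eb)) * (Ex / Ex) * (S / Ec)); first by ring.
by rewrite !divrr ?unitrM ?UEa // !mul1r.
Qed.

End Term.

Lemma RseriesE (R : comUnitRingType) (k i : nat) (a b x : {fps R}) :
  a \is a GRing.unit -> b \is a GRing.unit -> (1 <= i <= k)%N ->
  Rseries k i a b x fps_var = Rser a b k.-1 i.-1 x.
Proof.
case: i => // j; case: k => // K Ua Ub /= lejK.
pose c : {fps R} := qpoch_inf (x * fps_var) fps_var
  / (qpoch_inf (- a * x * fps_var) fps_var * qpoch_inf (- b * x * fps_var) fps_var).
have Uinf (z : {fps R}) := qpoch_inf_unit z.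
have e : fps_sum (fun n => c * Ssummand a b K j x n) = c * Sser a b K j x.
  exact/fps_sumZ/Ssummand_summable.
apply: (etrans _ (prefactor_algebra (Sser a b K j x) (Uinf x) (Uinf (- a * x))
  (Uinf (- b * x)) (Uinf (a * b * x)))).
rewrite /Rseries; congr (_ * _); apply: (etrans _ e); congr fps_sum.
apply/funext => n; apply: term_normalize => //.
- exact: qpoch_inf_rec.
- exact: unit_1subXn.
- exact: qpoch_unit.
- exact: qpoch_inf_split.
Qed.

(** * Truncation to finitely many part sizes *)

(* ((f_j(lambda), f_{\overline{j}}(lambda)), (f_j(mu), f_{\overline{j}}(mu))) for a
   part size j. *)
Definition level := ((nat * bool) * (nat * bool))%type.

Definition level_val (w : level) : nat :=
  (w.1.1 + w.1.2 + w.2.2 + [&& 0 < w.2.1, ~~ w.2.2, w.1.1 == 0 & ~~ w.1.2])%N.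
Definition level_s (w : level) : nat := (w.1.2 + w.2.1)%N.
Definition level_t (w : level) : nat := (w.2.1 + w.2.2)%N.
Definition level_m (w : level) : nat := (w.1.1 + w.1.2 + w.2.1 + w.2.2)%N.

(* [B] truncates the multiplicities in mu, which the valuations do not bound. *)
Definition levels (k B : nat) : seq level :=
  [seq (u, v) | u <- [seq (c, o) | c <- iota 0 k, o <- [:: false; true]],
                v <- [seq (d, o) | d <- iota 0 B, o <- [:: false; true]]].

(** * Sums over the multiplicities of a single part size *)

Section LevelSum.
Variables (A : comNzRingType) (a b z : A) (k B : nat) (G : nat -> A).
Hypotheses (k_gt0 : (0 < k)%N) (B_gt0 : (0 < B)%N).

Definition level_term (w : level) : A :=
  a ^+ level_s w * b ^+ level_t w * z ^+ level_m w.

Let D := \sum_(d <- iota 0 B) (a * b * z) ^+ d.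

Lemma big_bool_seq (f : bool -> A) : \sum_(o <- [:: false; true]) f o = f false + f true.
Proof. by rewrite !big_cons big_nil addr0. Qed.

Lemma sum_iota_pick n j (f : nat -> A) :
  \sum_(c <- iota 0 n) (c == j)%:R * f c = (j < n)%:R * f j.
Proof.
case: (ltnP j n) => [ltjn|lenj].
  rewrite (bigD1_seq j) ?iota_uniq ?mem_iota //= eqxx big1 ?addr0 // => c /negPf ->.
  by rewrite mul0r.
rewrite mul0r big_seq big1 // => c; rewrite mem_iota add0n => /andP[_ ltcn].
by rewrite ltn_eqF ?mul0r // (leq_trans ltcn).
Qed.

Lemma geometric_sum : (1 - a * b * z) * D = 1 - (a * b * z) ^+ B.
Proof.
rewrite /D -[X in iota 0 X]subn0 big_mkord -{2}(expr1n A B) subrXX.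
by congr (_ * _); apply: eq_bigr => d _; rewrite expr1n mul1r.
Qed.

(** [G c] weighs the larger sizes when the current one occurs [c] times non-overlined in lambda, the
    only datum the next condition depends on. *)
Definition level_sum (P : pred nat) : A :=
  \sum_(w <- levels k B | P (level_val w)) level_term w * G w.1.1.

(** The summands sort the levels by the number of overlined copies: none, one (in lambda or in mu,
    hence a + b), or two. With an overlined copy present the size cannot be unattached, so the sum
    over [d] is all of [D]. *)
Lemma level_sum_expand P : level_sum P =
  \sum_(c <- iota 0 k) (z ^+ c * G c) * (
    \sum_(d <- iota 0 B) (P (c + ((0 < d) && (c == 0)))%N)%:R * (a * b * z) ^+ d
    + (P c.+1)%:R * ((a + b) * z * D) + (P c.+2)%:R * (a * b * z ^+ 2 * D)).
Proof.
rewrite /level_sum /levels big_mkcond big_allpairs_dep big_allpairs_dep.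
apply: eq_bigr => c _; rewrite big_bool_seq !big_allpairs_dep -big_split.
rewrite /D !mulr_sumr -!big_split mulr_sumr; apply: eq_bigr => d _.
rewrite !big_bool_seq /level_term /level_val /level_s /level_t /level_m /=.
rewrite !andbT !andbF !addn0 !add0n !addn1.
have fE (C : bool) (f : A) : (if C then f else 0) = C%:R * f.
  by case: C; rewrite ?mul1r ?mul0r.
by rewrite !fE !(exprD, exprMn, exprS, expr0); ring.
Qed.

Lemma level_sum0 : level_sum (fun v => v < 1)%N = G 0%N.
Proof.
rewrite level_sum_expand.
transitivity (\sum_(c <- iota 0 k) (c == 0%N)%:R
  * (z ^+ c * G c * \sum_(d <- iota 0 B) (d == 0%N)%:R * (a * b * z) ^+ d)).
  apply: eq_bigr => -[|c] _; rewrite !ltnS !mul0r !addr0 ?mul1r ?mul0r.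
    by congr (_ * _); apply: eq_bigr => -[|d] _.
  by rewrite big1 ?mulr0 // => d _; rewrite addSn mul0r.
by rewrite !sum_iota_pick k_gt0 B_gt0 !expr0 !mul1r mulr1.
Qed.

(** The [c] collects the error of truncating the geometric series. For [m = 0] the last term comes
    from the unattached case, which contributes G(0)(D - 1), and D - 1 is abzD up to (abz)^B; hence
    the truncated predecessor in [G m.-1]. *)
Lemma level_sumS m : (m.+1 < k)%N -> exists c,
  (1 - a * b * z) * level_sum (pred1 m.+1)
  = z ^+ m.+1 * (G m.+1 + (a + b) * G m + a * b * G m.-1) + (a * b * z) ^+ B * c.
Proof.
move=> ltmk.
have -> : level_sum (pred1 m.+1)
  = z ^+ m.+1 * G m.+1 * D + z ^+ m * G m * ((a + b) * z * D)
    + (if m is m'.+1 then z ^+ m' * G m' * (a * b * z ^+ 2 * D)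
       else G 0%N * (D - 1)).
  rewrite level_sum_expand.
  transitivity (\sum_(c <- iota 0 k)
    ((c == m.+1)%:R * (z ^+ c * G c * D) + (c == m)%:R * (z ^+ c * G c * ((a + b) * z * D))
     + (c.+1 == m)%:R * (z ^+ c * G c * (a * b * z ^+ 2 * D))
     + (c == 0%N)%:R * ((m == 0%N)%:R * (z ^+ c * G c * (D - 1))))).
    apply: eq_bigr => c _; rewrite /= !eqSS.
    have -> : \sum_(d <- iota 0 B) ((c + ((0 < d) && (c == 0)))%N == m.+1)%:R * (a * b * z) ^+ d
      = (c == m.+1)%:R * D + (c == 0%N)%:R * ((m == 0%N)%:R * (D - 1)).
      case: c => [|c]; last first.
        rewrite mul0r addr0 mulr_sumr; apply: eq_bigr => d _.
        by rewrite andbF addn0.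
      rewrite !mul0r add0r mul1r /D; case: B B_gt0 => // B' _.
      rewrite /= !big_cons expr0 [1 + _]addrC addrK mul0r add0r mulr_sumr.
      rewrite -[1%N]addn0 iotaDl !big_map; apply: eq_bigr => d _.
      by rewrite add1n andbT add0n eqSS [0%N == m]eq_sym.
    by ring.
  rewrite !big_split /= !sum_iota_pick ltmk (ltnW ltmk) k_gt0 !mul1r.
  case: m ltmk => [|m] ltmk /=; first by rewrite big1 ?mul1r ?mulr1 ?addr0 // => c _; rewrite mul0r.
  rewrite mul0r addr0; under [X in _ + X = _]eq_bigr do rewrite eqSS.
  by rewrite sum_iota_pick (ltnW (ltnW ltmk)) mul1r.
have := geometric_sum; case: m ltmk => [|m] _ gs.
  exists (- (z * (G 1%N + (a + b) * G 0%N) + G 0%N)).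
  rewrite [LHS](_ : _ = z * (G 1%N + (a + b) * G 0%N) * ((1 - a * b * z) * D)
    + G 0%N * ((1 - a * b * z) * D - (1 - a * b * z))); last by ring.
  by rewrite gs; ring.
exists (- (z ^+ m.+2 * (G m.+2 + (a + b) * G m.+1 + a * b * G m))).
rewrite [LHS](_ : _ = z ^+ m.+2 * (G m.+2 + (a + b) * G m.+1 + a * b * G m)
  * ((1 - a * b * z) * D)); last by rewrite !exprS; ring.
by rewrite gs /=; ring.
Qed.

Lemma level_sum_ltS m : level_sum (fun v => v < m.+1)%N
  = level_sum (fun v => v < m)%N + level_sum (pred1 m).
Proof.
clear k_gt0 B_gt0. (* else lia makes the lemma depend on them *)
rewrite /level_sum (bigID (fun w => level_val w == m)) /= addrC; congr (_ + _).
  by apply: eq_bigl => w; lia.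
by apply: eq_bigl => w; lia.
Qed.

End LevelSum.

(** Multiplicities for [L] consecutive sizes. The bound handed on is [k - w.1.1] because f_j +
    v_(j+1) <= k - 1 means v_(j+1) < k - f_j. *)
Fixpoint confs (k B L i : nat) : seq (seq level) :=
  if L is L'.+1 then
    [seq w :: s | w <- [seq w <- levels k B | (level_val w < i)%N],
                  s <- confs k B L' (k - w.1.1)]
  else [:: [::]].

Fixpoint conf_term (A : comNzRingType) (a b x q : A) N (s : seq level) : A :=
  if s is w :: s' then level_term a b (x * q ^+ N) w * conf_term a b x q N.+1 s' else 1.

Lemma conf_sumS (A : comNzRingType) (a b x q : A) k B L N i :
  \sum_(s <- confs k B L.+1 i) conf_term a b x q N s
  = level_sum a b (x * q ^+ N) k B
      (fun c => \sum_(s <- confs k B L (k - c)) conf_term a b x q N.+1 s)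
      (fun v => v < i)%N.
Proof.
rewrite /= big_allpairs_dep big_filter; apply: eq_bigr => w _.
by rewrite /= mulr_sumr.
Qed.

Lemma mem_levels k B (w : level) : (w \in levels k B) = (w.1.1 < k)%N && (w.2.1 < B)%N.
Proof.
case: w => -[c al] [d be]; apply/allpairsP/andP => [[[u v] [uP vP [eu ev]]]|[ltck ltdB]].
  move: uP vP; rewrite -{u}eu -{v}ev.
  move=> /allpairsP[[c' o] [cP _ [-> _]]] /allpairsP[[d' o'] [dP _ [-> _]]].
  by move: cP dP; rewrite !mem_iota.
have mem_bool (o : bool) : o \in [:: false; true] by case: o.
by exists ((c, al), (d, be)); split => //; apply: allpairs_f; rewrite ?mem_iota.
Qed.

Section Truncation.
Variables (R : comUnitRingType) (a b : {fps R}) (M B : nat).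
Hypotheses (leMB : (M <= B)%N) (B_gt0 : (0 < B)%N).
Local Notation q := (fps_var : {fps R}).
Implicit Types y : {fps R}.

Lemma level_sum_eqmod z k (G G' : nat -> {fps R}) P :
  (forall c, (c < k)%N -> fps_eqmod M (G c) (G' c)) ->
  fps_eqmod M (level_sum a b z k B G P) (level_sum a b z k B G' P).
Proof.
move=> GG'; rewrite /level_sum big_seq_cond [X in fps_eqmod _ _ X]big_seq_cond.
apply: fps_eqmod_sum => w /andP[+ _]; rewrite mem_levels => /andP[ltk _].
by apply: fps_eqmodM => //; apply: GG'.
Qed.

Lemma fps_eqmodW (f g : {fps R}) : f = g -> fps_eqmod M f g.
Proof. by move->. Qed.

Lemma powB_eqmod0 y c : fps_eqmod M ((a * b * (y * q)) ^+ B * c) 0.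
Proof.
rewrite mulrA exprMn mulrAC mulrC.
by apply: fps_eqmod_varXM.
Qed.

Lemma level_sum_Rser K m y : (m <= K)%N ->
  fps_eqmod M (level_sum a b (y * q) K.+1 B (fun c => Rser a b K (K - c) (y * q))
                 (fun v => v < m.+1)%N)
              (Rser a b K m y).
Proof.
elim: m => [|m IHm] lemK.
  apply: fps_eqmodW; apply: (etrans (level_sum0 _ _ _ _ (ltn0Sn K) B_gt0)).
  by rewrite subn0; exact: (esym (Rser_base a b K y)).
pose G c := Rser a b K (K - c) (y * q).
apply: fps_eqmod_trans (fps_eqmodW (level_sum_ltS _ _ _ _ _ _ _)) _.
have [c Ec] := level_sumS a b (y * q) G (ltn0Sn K) B_gt0 (lemK : m.+1 < K.+1)%N.
have U : 1 - a * b * (y * q) \is a GRing.unit by rewrite mulrA (unit_1subXn _ 0).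
have EG : (y * q) ^+ m.+1 * (G m.+1 + (a + b) * G m + a * b * G m.-1)
    = (1 - a * b * (y * q)) * (Rser a b K m.+1 y - Rser a b K m y).
  rewrite [RHS](_ : _ = (1 - a * b * y * q) * (Rser a b K m.+1 y - Rser a b K m y)); last first.
    by rewrite mulrA.
  apply: (etrans _ (esym (Rser_rec a b y lemK))).
  have e1 : G m = Rser a b K (K - m.+1).+1 (y * q).
    by apply: (congr1 (fun j => Rser a b K j (y * q))); lia.
  have e2 : G m.-1 = Rser a b K (K - m.+1).+2 (y * q).
    (* For [m = 0] the index on the right is K + 1, and [Rser_top] brings it back to K. *)
    case: m {IHm c Ec e1} lemK => [|m] ltmK; last first.
      by apply: (congr1 (fun j => Rser a b K j (y * q))) => /=; lia.
    apply: (etrans (congr1 (fun j => Rser a b K j (y * q)) (subn0 K))).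
    apply: (etrans (esym (Rser_top a b K _))).
    by apply: (congr1 (fun j => Rser a b K j (y * q))); lia.
  exact: (f_equal2 (fun u v => (y * q) ^+ m.+1 * (G m.+1 + (a + b) * u + a * b * v)) e1 e2).
have step : fps_eqmod M (level_sum a b (y * q) K.+1 B G (pred1 m.+1))
                        (Rser a b K m.+1 y - Rser a b K m y).
  rewrite -[level_sum _ _ _ _ _ _ _](mulKr U) Ec EG.
  rewrite -[X in fps_eqmod _ _ X](mulKr U); apply: fps_eqmodM => //.
  rewrite -[X in fps_eqmod _ _ X]addr0; apply: fps_eqmodD => //.
  exact: powB_eqmod0.
have e3 := subrKC (Rser a b K m y) (Rser a b K m.+1 y).
apply: (fps_eqmod_trans _ (fps_eqmodW e3)).
by apply: fps_eqmodD; [apply: IHm; apply: ltnW | exact: step].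
Qed.

(** The sizes are N+1, ..., N+L. When none is left, N is at least M, so the argument x q^N vanishes
    modulo q^M and the series is 1, as is the sum over the empty list of levels. *)
Lemma conf_sum_Rser K (x : {fps R}) L N i :
  (0 < i <= K.+1)%N -> (M <= L + N)%N ->
  fps_eqmod M (\sum_(s <- confs K.+1 B L i) conf_term a b x q N.+1 s)
              (Rser a b K i.-1 (x * q ^+ N)).
Proof.
elim: L N i => [|L IHL] N i i_bd leM.
  rewrite big_seq1; apply: fps_eqmod_sym; apply: Rser_eqmod1.
  by rewrite mulrC; apply: fps_eqmod_varXM.
rewrite conf_sumS; case: i i_bd => // m lemSK.
have lemK : (m <= K)%N by [].
apply: (fps_eqmod_trans _ (level_sum_Rser (x * q ^+ N) lemK)).
have -> : x * q ^+ N * q = x * q ^+ N.+1 by rewrite -mulrA -exprSr.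
apply: level_sum_eqmod => c ltc.
have -> : (K - c = (K.+1 - c).-1)%N by lia.
by apply: IHL; lia.
Qed.

End Truncation.

(** * Overpartition pairs as lists of multiplicities *)

Local Close Scope ring_scope.

Definition level0 : level := ((0, false), (0, false)).

Fixpoint conf_weight (N : nat) (s : seq level) : nat :=
  if s is w :: s' then N * level_m w + conf_weight N.+1 s' else 0.

Lemma conf_termE (A : comNzRingType) (a b x q : A) N s :
  conf_term a b x q N s = (a ^+ sumn [seq level_s w | w <- s] * b ^+ sumn [seq level_t w | w <- s]
    * x ^+ sumn [seq level_m w | w <- s] * q ^+ conf_weight N s)%R.
Proof.
elim: s N => [|w s IHs] N; first by rewrite !mulr1.
rewrite /= IHs /level_term; move: (level_s w) (level_t w) (level_m w) => ns nt nm.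
rewrite !exprD exprMn [(q ^+ (N * _))%R]exprM; ring.
Qed.

Fixpoint conf_ok (k i : nat) (s : seq level) : bool :=
  if s is w :: s' then (level_val w < i) && conf_ok k (k - w.1.1) s' else true.

Lemma mem_confs k B L i s : (s \in confs k B L i) =
  [&& size s == L, all [pred w : level | (w.1.1 < k) && (w.2.1 < B)] s & conf_ok k i s].
Proof.
elim: L i s => [|L IHL] i [|w s] //=.
  by apply/allpairsPdep => -[w' [s' []]].
rewrite eqSS; apply/allpairsPdep/idP => [[w' [s' [+ + [-> ->]]]]|].
  by rewrite mem_filter mem_levels IHL => /andP[-> ->] /and3P[-> -> ->].
case/and3P=> sz /andP[bw bs] /andP[vw ok]; exists w, s; split=> //.
  by rewrite mem_filter vw mem_levels.
by rewrite IHL sz bs ok.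
Qed.

Lemma confs_uniq k B L i : uniq (confs k B L i).
Proof.
elim: L i => [|L IHL] i //=; apply: allpairs_uniq_dep => //.
  apply: filter_uniq; apply: allpairs_uniq => [||[? ?] [? ?] _ _ [-> ->] //];
    by apply: allpairs_uniq => [||[? ?] [? ?] _ _ [-> ->] //]; rewrite ?iota_uniq.
by move=> [w s] [w' s'] _ _ /= [-> ->].
Qed.

(** Past the end of [s] the default [level0] has valuation 0, so the conditions there reduce to f_j
    < k. That bound also keeps the successive bounds [k - w.1.1] positive. *)
Lemma conf_okP k i s : 0 < i -> all (fun w : level => w.1.1 < k) s -> 0 < k ->
  conf_ok k i s <-> level_val (nth level0 s 0) < i
    /\ forall j, (nth level0 s j).1.1 + level_val (nth level0 s j.+1) < k.
Proof.
move=> i_gt0 + k_gt0; elim: s i i_gt0 => [|w s IHs] i i_gt0 /=.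
  by split=> // _; split=> // j; rewrite !nth_nil.
case/andP=> ltwk /IHs {}IHs; split=> [/andP[vw /IHs[|v0 vs]]|[vw vs]].
- by rewrite subn_gt0.
- by split=> // -[|j] /=; [lia | apply: vs].
- rewrite vw; apply/IHs; first by rewrite subn_gt0.
  by split=> [|j]; [have := vs 0 => /=; lia | apply: (vs j.+1)].
Qed.

(** The relation inside [is_overpartition]. It is irreflexive at overlined parts, so these cannot
    repeat; being transitive and antisymmetric, it lets a sorted list be recovered from its
    multiplicities. *)
Definition part_geq (p p' : nat * bool) := (p'.1 <= p.1) && (p'.2 ==> (p'.1 < p.1)).

Lemma part_geq_trans : transitive part_geq.
Proof. by move=> [j o] [j1 o1] [j2 o2]; rewrite /part_geq /=; case: o o2 => [] []; lia. Qed.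

Lemma part_geq_anti : antisymmetric part_geq.
Proof.
move=> [j o] [j1 o1]; rewrite /part_geq /= => h.
have -> : j = j1 by lia.
by move: h; case: o o1 => [] [] //=; lia.
Qed.

Lemma mem_count (T : eqType) (x : T) s : (x \in s) = (0 < count_mem x s).
Proof. by rewrite -has_count has_pred1. Qed.

(** Larger sizes are put in front, and within a size the overlined copy comes first, as sortedness
    for [part_geq] requires. *)
Fixpoint build (N : nat) (l : seq (nat * bool)) : seq (nat * bool) :=
  if l is (c, o) :: l' then build N.+1 l' ++ nseq o (N, true) ++ nseq c (N, false)
  else [::].

Lemma build_ge N l : all (fun p => N <= p.1) (build N l).
Proof.
elim: l N => [|[c o] l IHl] N //=; rewrite !all_cat !all_nseq /= leqnn !orbT !andbT.
by apply: sub_all (IHl N.+1) => p; apply: ltnW.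
Qed.

Lemma build_sorted N l : pairwise part_geq (build N l).
Proof.
elim: l N => [|[c o] l IHl] N //=; rewrite !pairwise_cat IHl allrel_catr.
have -> : pairwise part_geq (nseq c (N, false)).
  by elim: c => //= c ->; rewrite all_nseq /part_geq /= leqnn !orbT.
have -> : pairwise part_geq (nseq o (N, true)) by case: o.
rewrite !andbT /= -andbA; apply/and3P; split.
- apply/allrelP => p p' /(allP (build_ge _ _)) ltNp /nseqP[-> _].
  by rewrite /part_geq /= ltNp ltnW.
- apply/allrelP => p p' /(allP (build_ge _ _)) ltNp /nseqP[-> _].
  by rewrite /part_geq /= ltnW.
- by apply/allrelP => p p' /nseqP[-> _] /nseqP[-> _]; rewrite /part_geq /= leqnn.
Qed.

Lemma build_overpartition l : is_overpartition (build 1 l).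
Proof.
by rewrite /is_overpartition build_ge sorted_pairwise ?build_sorted //; exact: part_geq_trans.
Qed.

Lemma count_build N l j o : count_mem (N + j, o) (build N l)
  = if o then nat_of_bool (nth (0, false) l j).2 else (nth (0, false) l j).1.
Proof.
elim: l N j => [|[c o'] l IHl] N j /=; first by rewrite nth_nil; case: o.
rewrite !count_cat !count_nseq /= !xpair_eqE; case: j => [|j] /=.
  rewrite addn0 eqxx /=.
  have /count_memPn -> : (N, o) \notin build N.+1 l.
    by apply/negP => /(allP (build_ge _ _)) /=; rewrite ltnn.
  by case: o {IHl}; rewrite /= ?mul1n ?mul0n ?addn0.
have -> : (N == N + j.+1) = false by lia.
by rewrite -addSnnS IHl !mul0n !addn0.
Qed.

Lemma size_build N l : size (build N l) = sumn [seq p.1 + nat_of_bool p.2 | p <- l].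
Proof. by elim: l N => [|[c o] l IHl] N //=; rewrite !size_cat !size_nseq IHl; lia. Qed.

Lemma count_over_build N l : count (fun p => p.2) (build N l) = sumn [seq nat_of_bool p.2 | p <- l].
Proof. by elim: l N => [|[c o] l IHl] N //=; rewrite !count_cat !count_nseq IHl /=; lia. Qed.

Lemma count_nonover_build N l : count (fun p => ~~ p.2) (build N l) = sumn [seq p.1 | p <- l].
Proof. by elim: l N => [|[c o] l IHl] N //=; rewrite !count_cat !count_nseq IHl /=; lia. Qed.

(** A single overpartition is viewed as a pair with empty mu, so that [conf_weight] can be
    reused. *)
Lemma sumn_build N l :
  sumn [seq p.1 | p <- build N l] = conf_weight N [seq (p, (0, false)) | p <- l].
Proof.
elim: l N => [|[c o] l IHl] N //=.
by rewrite !map_cat !sumn_cat !map_nseq !sumn_nseq IHl /level_m /=; lia.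
Qed.

Definition overpartition_of (l : seq (nat * bool)) := Overpartition (build_overpartition l).

(** Both lists are sorted for [part_geq], so it is enough to compare multiplicities. *)
Lemma overpartition_ofK M (l : overpartition) :
  all (fun p => p.1 <= M) (op_parts l) ->
  overpartition_of [seq (freq j l, (j, true) \in op_parts l) | j <- iota 1 M] = l.
Proof.
case: l => l /= Hl leM; apply: val_inj => /=; have /andP[posl sortl] := Hl.
apply: (sorted_eq part_geq_trans part_geq_anti) => //.
  by have /andP[] := build_overpartition [seq (count_mem (j, false) l, (j, true) \in l) | j <- iota 1 M].
apply/allP => -[[|j] o] _ /=; apply/eqP.
  transitivity 0; first by apply/count_memPn/negP => /(allP (build_ge _ _)).
  by apply/esym/count_memPn/negP => /(allP posl).
rewrite -[in LHS]add1n count_build; case: (ltnP j M) => [ltjM|leMj]; last first.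
  rewrite nth_default ?size_map ?size_iota //; transitivity 0; first by case: o.
  by apply/esym/count_memPn/negP => /(allP leM) /=; rewrite ltnNge leMj.
rewrite (nth_map 0) ?size_iota // nth_iota // add1n; case: o => //=.
(* For an overlined part, multiplicity and membership agree because sortedness excludes a second
   copy. *)
have: pairwise part_geq l by rewrite -sorted_pairwise //; exact: part_geq_trans.
rewrite mem_count; elim: (l) => //= p l' IHl /andP[pl /IHl].
case: eqP pl => [-> pl _|_ _] /=; last by rewrite add0n.
suff /count_memPn -> : (j.+1, true) \notin l' by [].
by apply/negP => /(allP pl); rewrite /part_geq /= ltnn andbF.
Qed.

(** * The correspondence between pairs and lists of multiplicities *)

Definition pair_of (c : seq level) : overpartition * overpartition :=
  (overpartition_of [seq w.1 | w <- c], overpartition_of [seq w.2 | w <- c]).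

Definition conf_of M (lm : overpartition * overpartition) : seq level :=
  [seq ((freq j lm.1, (j, true) \in op_parts lm.1), (freq j lm.2, (j, true) \in op_parts lm.2))
  | j <- iota 1 M].

Lemma conf_ofK M (lm : overpartition * overpartition) :
  all (fun p => p.1 <= M) (op_parts lm.1) -> all (fun p => p.1 <= M) (op_parts lm.2) ->
  pair_of (conf_of M lm) = lm.
Proof.
case: lm => la mu /= leMla leMmu.
by rewrite /pair_of /conf_of -!map_comp; congr pair; apply: overpartition_ofK.
Qed.

Lemma freq_overpartition_of l j : freq j.+1 (overpartition_of l) = (nth (0, false) l j).1.
Proof. exact: (count_build 1 l j false). Qed.

Lemma freq_over_overpartition_of l j :
  freq_over j.+1 (overpartition_of l) = (nth (0, false) l j).2.
Proof. exact: (count_build 1 l j true). Qed.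

Lemma mem_overpartition_of l j :
  ((j.+1, true) \in op_parts (overpartition_of l)) = (nth (0, false) l j).2.
Proof.
by rewrite mem_count -[count_mem _ _]/(freq_over j.+1 _) freq_over_overpartition_of lt0b.
Qed.

Lemma nth_fst (c : seq level) j : nth (0, false) [seq w.1 | w <- c] j = (nth level0 c j).1.
Proof.
case: (ltnP j (size c)) => [ltj|lej]; first by rewrite (nth_map level0).
by rewrite !nth_default ?size_map.
Qed.

Lemma nth_snd (c : seq level) j : nth (0, false) [seq w.2 | w <- c] j = (nth level0 c j).2.
Proof.
case: (ltnP j (size c)) => [ltj|lej]; first by rewrite (nth_map level0).
by rewrite !nth_default ?size_map.
Qed.

Lemma pair_ofK M c : size c = M -> conf_of M (pair_of c) = c.
Proof.
move=> szc; apply: (@eq_from_nth _ level0); rewrite size_map size_iota // => j ltjM.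
rewrite (nth_map 0) ?size_iota // nth_iota // add1n !freq_overpartition_of.
rewrite !mem_overpartition_of !nth_fst !nth_snd.
by case: (nth level0 c j) => -[? ?] [? ?].
Qed.

Lemma valuation_pair_of c j :
  valuation j.+1 (pair_of c).1 (pair_of c).2 = level_val (nth level0 c j).
Proof.
rewrite /valuation /unattached !freq_overpartition_of !freq_over_overpartition_of.
rewrite !mem_overpartition_of ![(j.+1, false) \in _]mem_count.
rewrite -![count_mem _ _]/(freq j.+1 _) !freq_overpartition_of !nth_fst !nth_snd.
by rewrite /level_val -eqn0Ngt.
Qed.

Definition conf_stats (s t m n : nat) (c : seq level) : bool :=
  [&& sumn [seq level_s w | w <- c] == s, sumn [seq level_t w | w <- c] == t,
      sumn [seq level_m w | w <- c] == m & conf_weight 1 c == n].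

Lemma conf_weight_pair N (c : seq level) : conf_weight N c
  = conf_weight N [seq (p, (0, false)) | p <- [seq w.1 | w <- c]]
    + conf_weight N [seq (p, (0, false)) | p <- [seq w.2 | w <- c]].
Proof. by elim: c N => [|[[? ?] [? ?]] c IHc] N //=; rewrite IHc /level_m /=; lia. Qed.

Lemma sumn_mapD (T : Type) (f g : T -> nat) (c : seq T) :
  sumn [seq f x + g x | x <- c] = sumn [seq f x | x <- c] + sumn [seq g x | x <- c].
Proof. by elim: c => //= x c ->; lia. Qed.

Lemma overpartition_pairs_pair_of k i s t m n c : 0 < i -> 0 < k ->
  overpartition_pairs k i s t m n (pair_of c) <->
  [/\ conf_stats s t m n c, level_val (nth level0 c 0) < i
    & forall j, (nth level0 c j).1.1 + level_val (nth level0 c j.+1) < k].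
Proof.
move=> i_gt0 k_gt0; rewrite /overpartition_pairs /pair_of /=.
rewrite -/(pair_of c).1 -/(pair_of c).2 (valuation_pair_of c 0).
have -> : op_weight (pair_of c).1 + op_weight (pair_of c).2 = conf_weight 1 c.
  by rewrite /op_weight !sumn_build -conf_weight_pair.
rewrite !size_build count_over_build count_nonover_build -!map_comp /=.
rewrite /conf_stats /level_s /level_t /level_m !sumn_mapD.
have sub1 x y : 0 < y -> (x <= y - 1) = (x < y) by lia.
rewrite sub1 //; split=> [[[<- <- <- <-] v0 vs]|[/and4P[/eqP<- /eqP<- /eqP<- /eqP<-] v0 vs]].
  split=> // [|j]; first by rewrite !addnA !eqxx.
  have := vs j.+1 isT.
  by rewrite freq_overpartition_of nth_fst (valuation_pair_of c j.+1) sub1.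
split=> // [|[|j] // _]; first by rewrite !addnA.
by rewrite freq_overpartition_of nth_fst (valuation_pair_of c j.+1) sub1.
Qed.

(** Bounds the multiplicities in mu by the weight, so the truncation in [levels] loses no pair. *)
Lemma level_m_le_weight N c w : 0 < N -> w \in c -> level_m w <= conf_weight N c.
Proof.
elim: c N => // w' c IHc N N_gt0; rewrite inE => /predU1P[->|wc] /=.
  by apply: leq_trans (leq_addr _ _); rewrite leq_pmull.
by apply: leq_trans (IHc N.+1 _ wc) (leq_addl _ _).
Qed.

(** In a pair of weight n neither a part nor a multiplicity exceeds n, so [n.+1] is enough for both
    bounds; it is also the precision needed to read off the coefficient of q^n. *)
Definition conf_count k i s t m n :=
  count (conf_stats s t m n) (confs k n.+1 n.+1 i).

Lemma part_le_sumn (l : seq (nat * bool)) p : p \in l -> p.1 <= sumn [seq p.1 | p <- l].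
Proof.
elim: l => // p' l IHl; rewrite inE => /predU1P[->|/IHl pl] /=; first exact: leq_addr.
exact: leq_trans pl (leq_addl _ _).
Qed.

Lemma mem_confs_pair_of k i s t m n c : 0 < i -> 0 < k -> size c = n.+1 ->
  overpartition_pairs k i s t m n (pair_of c) <->
  c \in [seq c <- confs k n.+1 n.+1 i | conf_stats s t m n c].
Proof.
move=> i_gt0 k_gt0 szc; rewrite mem_filter mem_confs szc eqxx andTb.
rewrite overpartition_pairs_pair_of //; split=> [[st v0 vs]|/and3P[st bc ok]].
  have ck : all (fun w : level => w.1.1 < k) c.
    by apply/(all_nthP level0) => j _; apply: leq_ltn_trans (vs j); apply: leq_addr.
  rewrite st andTb; apply/andP; split; last exact/(conf_okP i_gt0 ck k_gt0).
  apply/allP => w wc /=; rewrite (allP ck) //= ltnS.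
  have /and4P[_ _ _ /eqP<-] := st; apply: leq_trans (level_m_le_weight _ wc) => //.
  by rewrite /level_m; lia.
have ck : all (fun w : level => w.1.1 < k) c by apply: sub_all bc => w /andP[].
by have /(conf_okP i_gt0 ck k_gt0)[] := ok.
Qed.

(** A pair is sent to the index of its list of multiplicities in the duplicate-free list [cl]. *)
Lemma card_overpartition_pairs k i s t m n : 0 < i -> 0 < k ->
  (overpartition_pairs k i s t m n #= `I_(conf_count k i s t m n))%card.
Proof.
move=> i_gt0 k_gt0; set cl := [seq c <- confs k n.+1 n.+1 i | conf_stats s t m n c].
have -> : conf_count k i s t m n = size cl by rewrite size_filter.
have ucl : uniq cl by rewrite filter_uniq ?confs_uniq.
have szof lm : size (conf_of n.+1 lm) = n.+1 by rewrite size_map size_iota.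
have ofK lm : overpartition_pairs k i s t m n lm -> pair_of (conf_of n.+1 lm) = lm.
  case: lm => la mu [[wn _ _ _] _ _].
  by apply: conf_ofK; apply/allP => p /part_le_sumn /= lep;
    apply: (leq_trans lep); rewrite -[sumn _]/(op_weight _); lia.
have mem_cl lm : overpartition_pairs k i s t m n lm -> conf_of n.+1 lm \in cl.
  by move=> lmP; apply/mem_confs_pair_of => //; rewrite ofK.
apply/card_set_bijP; exists (fun lm => index (conf_of n.+1 lm) cl); split.
- by move=> lm /mem_cl; rewrite /= index_mem.
- move=> lm lm' /[!inE] lmP lmP' e; rewrite -(ofK lm lmP) -(ofK lm' lmP'); congr pair_of.
  by rewrite -(nth_index [::] (mem_cl _ lmP)) e nth_index // mem_cl.
- move=> j /= ltj; have ccl := mem_nth [::] ltj; set c := nth [::] cl j in ccl.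
  have szc : size c = n.+1.
    by move: ccl; rewrite mem_filter mem_confs => /and3P[_ /eqP].
  exists (pair_of c); first exact/mem_confs_pair_of.
  by rewrite pair_ofK // /c index_uniq.
Qed.

(** * The expansion *)

Local Open Scope ring_scope.

Section Monomials.
Variable R : comNzRingType.

Lemma fps_constM (c d : R) : fps_const c * fps_const d = fps_const (c * d).
Proof.
apply/fpsP => n; rewrite coef_fpsM big_ord_recl subn0 big1 ?addr0.
  by case: n => //= n; rewrite mulr0.
by move=> j _; rewrite mul0r.
Qed.

Lemma fps_constX (c : R) n : fps_const c ^+ n = fps_const (c ^+ n).
Proof. by elim: n => // n IHn; rewrite !exprS IHn fps_constM. Qed.

Lemma coef_fps_constMX (c : R) n m : (fps_const c * fps_var ^+ n) m = (n == m)%:R * c.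
Proof.
rewrite mulrC coef_fps_varXM; case: ltngtP => [ltmn|ltnm|->].
- by rewrite mul0r.
- by rewrite mul0r -(subnSK ltnm).
- by rewrite subnn mul1r.
Qed.

End Monomials.

Definition mon_ab (s t : nat) : {poly {poly int}} := 'X^s * ('X^t)%:P.

Lemma coef_mon_ab s t i j : (mon_ab s t)`_i`_j = ((s == i) && (t == j))%:R.
Proof.
rewrite /mon_ab coefMC coefXn eq_sym; case: eqP => _; last by rewrite mul0r coef0.
by rewrite mul1r coefXn eq_sym.
Qed.

Lemma coef_ser_monomial s t m n n' m' :
  (ser_a ^+ s * ser_b ^+ t * ser_x ^+ m * ser_q ^+ n) n' m'
  = if (m == m') && (n == n') then tofrac (mon_ab s t) else 0.
Proof.
have -> : tofrac (mon_ab s t) = (tofrac 'X : Qab) ^+ s * (tofrac 'X%:P : Qab) ^+ t.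
  by rewrite /mon_ab rmorphM !rmorphXn.
rewrite /ser_a /ser_b /ser_x !fps_constX fps_constM fps_constM fps_constM.
rewrite /ser_q coef_fps_constMX.
case: (n == n'); rewrite ?andbT ?andbF ?mul0r ?coef_fps0 // mul1r coef_fps_constMX.
by case: (m == m'); rewrite ?mul0r ?mul1r.
Qed.

Lemma fps_const_unit (R : comUnitRingType) (c : R) :
  c \is a GRing.unit -> fps_const c \is a GRing.unit.
Proof. by []. Qed.

Lemma ser_unit (p : {poly {poly int}}) : p != 0 ->
  (fps_const (fps_const (tofrac p)) : Qabxq) \is a GRing.unit.
Proof.
move=> p_neq0; apply: fps_const_unit; apply: fps_const_unit.
have Up : (tofrac p : Qab) != 0 by rewrite tofrac_eq0.
by rewrite unitfE.
Qed.

Lemma R_expansion k i : (1 <= i <= k)%N ->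
  has_expansion (R_ k i) (fun s t m n => (conf_count k i s t m n)%:Z).
Proof.
(* The polynomial keeps [a] and [b] free and fixes only the number of parts and the weight. *)
move=> ik m n; exists (\sum_(c <- confs k n.+1 n.+1 i
    | (sumn [seq level_m w | w <- c] == m) && (conf_weight 1 c == n))
    mon_ab (sumn [seq level_s w | w <- c]) (sumn [seq level_t w | w <- c])); last first.
  move=> s t; rewrite !coef_sum /conf_count -sum1_count big_mkcond [in RHS]big_mkcond.
  rewrite -natz natr_sum; apply: eq_bigr => c _; rewrite /conf_stats.
  by case: ifP => mn; rewrite ?coef_mon_ab ?mn; do 2 case: (_ == _).
have k_gt0 : (0 < k)%N by move: ik => /andP[]; apply: leq_trans.
have Ua : ser_a \is a GRing.unit by apply: ser_unit; rewrite polyX_eq0.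
have Ub : ser_b \is a GRing.unit by apply: ser_unit; rewrite polyC_eq0 polyX_eq0.
have eR : R_ k i = Rser ser_a ser_b k.-1 i.-1 ser_x := RseriesE ser_x Ua Ub ik.
have ik1 : (0 < i <= k.-1.+1)%N by rewrite prednK.
have leM : (n.+1 <= n.+1 + 0)%N by rewrite addn0.
(* Sizes 1 to n+1, multiplicities in mu at most n, precision q^(n+1), and N = 0 so that the argument
   is x itself. *)
have := conf_sum_Rser ser_a ser_b (leqnn n.+1) (ltn0Sn n) ser_x ik1 leM (ltnSn n).
rewrite prednK // mulr1 eR => <-; rewrite !coef_fps_sum.
rewrite [RHS](rmorph_sum (@tofrac _)) [RHS]big_mkcond; apply: eq_bigr => c _.
by rewrite conf_termE coef_ser_monomial.
Qed.

(** Holds because [tofrac] is injective on polynomials. *)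
Lemma has_expansion_unique F r r' :
  has_expansion F r -> has_expansion F r' -> forall s t m n, r s t m n = r' s t m n.
Proof.
move=> Fr Fr' s t m n; have [p ep <-] := Fr m n; have [p' ep' <-] := Fr' m n.
by have /eqP := etrans (esym ep) ep'; rewrite tofrac_eq => /eqP ->.
Qed.

Theorem theorem1 (k i : nat) (hk : (2 <= k)%N) (hi : (1 <= i <= k)%N) :
  (exists r, has_expansion (R_ k i) r) /\
  (forall r, has_expansion (R_ k i) r ->
    forall s t m n : nat,
      exists2 c : nat, (overpartition_pairs k i s t m n #= `I_c)%card
                     & r s t m n = c%:Z%R).
Proof.
have i_gt0 : (0 < i)%N by have /andP[] := hi.
have k_gt0 : (0 < k)%N by apply: leq_trans hk.
have Rr := R_expansion hi; split; first by exists (fun s t m n => (conf_count k i s t m n)%:Z).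
move=> r Er s t m n; exists (conf_count k i s t m n).
  exact: card_overpartition_pairs.
exact: has_expansion_unique Er Rr s t m n.
Qed.
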